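(* Let $\Theta^u,\Theta^\ell : C\to[0,r]$ be continuous with $0\le \Theta^\ell(\varphi)\le\Theta^u(\varphi)\le r$ and $\Theta^\ell(\varphi)>0$ for all $\varphi\in C$. Assume that the delay function $\eta : C\to[0,r]$ is continuous and satisfies the following state-dependent condition: for all $\varphi,\psi\in C$, if $\psi(\theta)=\varphi(\theta)$ for all $\theta\in[-\Theta^u(\varphi),-\Theta^\ell(\varphi)]$, then $\eta(\psi)=\eta(\varphi)$. Assume that $B : L^2(\Omega)\to L^2(\Omega)$ is Lipschitz continuous, i.e. there is $L_B$ with $\|B(v^1)-B(v^2)\|\le L_B\|v^1-v^2\|$ for all $v^1,v^2\in L^2(\Omega)$. Then for every initial function $\varphi\in C$ the initial value problem $$\frac{\partial}{\partial t}u(t,x)+Au(t,x)+d\,u(t,x)=\big(B(u(t-\eta(u_t)))\big)(x),\quad x\in\Omega,\ t>0,\qquad u|_{[-r,0]}=\varphi,$$ has a unique global mild solution $u\in C([-r,+\infty);L^2(\Omega))$. Moreover, if $S_t : C\to C$ is defined for $t\ge0$ by $S_t\varphi= u_t$, where $u$ is the unique mild solution with initial function $\varphi$, then $(S_t,C)$ is a dynamical system, i.e. 1. $S_0=\mathrm{Id}$ (the identity operator in $C$); 2. $S_tS_\tau=S_{t+\tau}$ for all $t,\tau\ge0$; 3. $t\mapsto S_t$ is strongly continuous in $C$ (for every $\varphi\in C$ the map $t\mapsto S_t\varphi\in C$ is continuous on $[0,\infty)$); 4. for every $t\ge0$ the operator $S_t$ is continuous in $C$: if $\varphi^n,\varphi\in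 C$ and $\|\varphi^n-\varphi\|_C\to0$ as $n\to\infty$, then $\|S_t\varphi^n-S_t\varphi\|_C\to0$ as $n\to\infty$.
   Context: Setting: $\Omega\subset\mathbb{R}^{n_0}$ is a smooth bounded domain; $r>0$ and $d\ge0$ are constants; $A$ is a densely defined self-adjoint positive linear operator with domain $D(A)\subset L^2(\Omega)$ and compact resolvent, so that $-A$ generates the analytic semigroup $e^{-At}$ on $L^2(\Omega)$. Notation: $C= C([-r,0];L^2(\Omega))$ with the sup-norm $\|\cdot\|_C$; $\|\cdot\|$ is the norm of $L^2(\Omega)$. For a function $u$ on an interval containing $[t-r,t]$, $u_t\in C$ is defined by $u_t(\theta)=u(t+\theta)$, $\theta\in[-r,0]$. The delay term is $F(\varphi)=B(\varphi(-\eta(\varphi)))$, $\varphi\in C$. Mild solution: $u\in C([-r,T];L^2(\Omega))$ is a mild solution on $[-r,T]$ of the initial value problem if $u|_{[-r,0]}=\varphi$ and $$u(t)=e^{-At}\varphi(0)+\int_0^t e^{-A(t-s)}\{F(u_s)-d\,u(s)\}\,ds,\quad t\in[0,T].$$ A global mild solution is $u\in C([-r,+\infty);L^2(\Omega))$ whose restriction to $[-r,T]$ is a mild solution for every $T>0$. *)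

(* Defs.v *)
From HB Require Import structures.
From mathcomp Require Import all_boot all_order all_algebra.
From mathcomp Require Import all_classical all_reals all_analysis.
From mathcomp Require Import measurable_realfun measurable_fun_approximation.
From mathcomp Require Import ess_sup_inf.
From mathcomp Require Import lra.

Set Implicit Arguments.
Unset Strict Implicit.
Unset Printing Implicit Defensive.
Import Order.TTheory GRing.Theory Num.Theory.
Import numFieldNormedType.Exports.
Local Open Scope classical_set_scope.
Local Open Scope ring_scope.

(* Lebesgue measure on R^(n+1), on the Lebesgue (Caratheodory) sigma-algebra.
   The dimension is a successor: in dimension 0 the empty product would give
   the empty set outer measure 1. *)
Section lebesgue_outer_measure.
Context {R : realType} {n : nat}.
Local Notation E := 'rV[R]_n.+1.
Implicit Types (q : E * E) (A : set E).

Definition box q : set E := [set x | forall i, q.1 0 i <= x 0 i <= q.2 0 i].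

Definition box_volume q : R := \prod_i Num.max 0 (q.2 0 i - q.1 0 i).

Lemma box_volume_ge0 q : 0 <= box_volume q.
Proof. by apply: prodr_ge0 => i _; rewrite le_max lexx. Qed.

Definition box_cover A : set (nat -> E * E) :=
  [set Q | A `<=` \bigcup_k box (Q k)].

Definition lebesgue_outer A : \bar R :=
  ereal_inf [set (\sum_(k <oo) (box_volume (Q k))%:E)%E | Q in box_cover A].

Local Open Scope ereal_scope.

Lemma le_lebesgue_outer :
  {homo lebesgue_outer : A B / A `<=` B >-> A <= B}.
Proof.
move=> A B AB; apply/ereal_inf_le_tmp => x [Q QB <-]; exists Q => //.
exact: subset_trans AB QB.
Qed.

Lemma lebesgue_outer_ge0 A : 0 <= lebesgue_outer A.
Proof.
apply: le_ereal_inf_tmp => x [Q QA <-{x}].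
by apply: nneseries_ge0 => k _ _; rewrite lee_fin box_volume_ge0.
Qed.

Lemma lebesgue_outer0 : lebesgue_outer set0 = 0.
Proof.
apply/eqP; rewrite eq_le lebesgue_outer_ge0 andbT.
apply: ereal_inf_lbound; exists (fun=> (0%R, 0%R)); first by [].
rewrite eseries0// => k _ _.
by rewrite /box_volume big_ord_recl/= subrr maxxx mul0r.
Qed.

Lemma lebesgue_outer_sigma_subadditive : sigma_subadditive lebesgue_outer.
Proof.
move=> A; have [[i ioo]|] := pselect (exists i, lebesgue_outer (A i) = +oo).
  rewrite (eseries_pinfty _ _ ioo) ?leey// => k _.
  by rewrite -ltNye (lt_le_trans _ (lebesgue_outer_ge0 _)).
rewrite -forallNE => Aoo.
suff add2e (e : {posnum R}) : lebesgue_outer (\bigcup_k A k) <=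
    \sum_(i <oo) lebesgue_outer (A i) + e%:num%:E.
  by apply/lee_addgt0Pr => _/posnumP[].
rewrite (le_trans _ (epsilon_trick _ _ _))//; last first.
  by move=> k; exact: lebesgue_outer_ge0.
pose P k Q := box_cover (A k) Q /\ \sum_(j <oo) (box_volume (Q j))%:E <=
   lebesgue_outer (A k) + (e%:num / (2 ^ k.+1)%:R)%:E.
have [G PG] : {G & forall k, P k (G k)}.
  apply: (@choice _ _ P) => k; rewrite /P /lebesgue_outer.
  set S := (X in ereal_inf X); move infS : (ereal_inf S) => iS.
  case: iS infS => [r Sr|Soo|Soo].
  - have en1 : (0 < e%:num / (2 ^ k.+1)%:R)%R by [].
    have /(lb_ereal_inf_adherent en1) : ereal_inf S \is a fin_num by rewrite Sr.
    move=> [x [Q QA <-] xS].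
    by exists Q; split => //; rewrite -Sr; exact/ltW.
  - by have := Aoo k; rewrite /lebesgue_outer Soo.
  - suff : lbound S 0 by move/le_ereal_inf_tmp; rewrite Soo.
    move=> /= _ [Q QA <-].
    by apply: nneseries_ge0 => j _ _; rewrite lee_fin box_volume_ge0.
pose v := EFin \o box_volume.
have v_ge0 x : 0 <= (v \o uncurry G) x by rewrite lee_fin box_volume_ge0.
apply: (@le_trans _ _ (\esum_(i in setT) (v \o uncurry G) i)).
  apply: ereal_inf_lbound => /=.
  have /card_esym/ppcard_eqP[f] := card_nat2.
  exists (uncurry G \o f).
    move=> t [i _ Ait]; have [j _ Gijt] := (PG i).1 _ Ait.
    by exists (f^-1%FUN (i, j)) => //=; rewrite invK ?inE.
  rewrite -(esum_pred_image (v \o uncurry G) _ xpredT) ?[fun=> _]set_true//.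
  by rewrite image_eq.
rewrite (_ : esum _ _ = \sum_(i <oo) \sum_(j <oo) v (G i j)); last first.
  pose J : nat -> set (nat * nat) := fun i => [set (i, j) | j in setT].
  rewrite (_ : setT = \bigcup_k J k); last first.
    by rewrite predeqE => -[a b]; split => // _; exists a => //; exists b.
  rewrite esum_bigcupT /=; last 2 first.
    - apply/trivIsetP => i j _ _ ij.
      rewrite predeqE => -[k m] /=; split => //= -[] [_] _ [<-{k} _].
      by move=> [m' _] [] /esym/eqP; rewrite (negbTE ij).
    - by move=> x; rewrite lee_fin box_volume_ge0.
  rewrite -(image_id [set: nat]) -fun_true esum_pred_image//; last first.
    by move=> k _; apply: esum_ge0 => x _; rewrite lee_fin box_volume_ge0.
  apply: eq_eseriesr => /= j _.
  rewrite -(esum_pred_image (v \o uncurry G) (pair j) predT)//=.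
  - by congr esum; rewrite predeqE => -[a b]; split; move=> [i _ <-]; exists i.
  - by move=> k _; exact: (v_ge0 (j, k)).
  - by move=> ? ? _ _; exact: (@can_inj _ _ _ snd).
apply: lee_nneseries => [i _ _|i _].
  by apply: nneseries_ge0 => j _ _; rewrite lee_fin box_volume_ge0.
exact: (PG i).2.
Qed.

HB.instance Definition _ := isOuterMeasure.Build R E lebesgue_outer
  lebesgue_outer0 lebesgue_outer_ge0 le_lebesgue_outer
  lebesgue_outer_sigma_subadditive.

End lebesgue_outer_measure.

Definition lebesgueType (R : realType) (n : nat) : Type :=
  caratheodory_type (@lebesgue_outer R n).
HB.instance Definition _ (R : realType) (n : nat) :=
  Measurable.on (lebesgueType R n).

Definition lebesgue_rV (R : realType) (n : nat) :
  set (lebesgueType R n) -> \bar R := @lebesgue_outer R n.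
HB.instance Definition _ (R : realType) (n : nat) :=
  isMeasure.Build _ (lebesgueType R n) R (@lebesgue_rV R n)
    (@caratheodory_measure0 _ _ (@lebesgue_outer R n))
    (@caratheodory_measure_ge0 _ _ (@lebesgue_outer R n))
    (@caratheodory_measure_sigma_additive _ _ (@lebesgue_outer R n)).

Section lebesgue_measurable_open.
Context {R : realType} {n : nat}.
Local Notation E := 'rV[R]_n.+1.

Lemma halfspace_lebesgue_measurable (i0 : 'I_n.+1) (c : R) (H : set E) :
  (forall x, H x -> x 0 i0 <= c) -> (forall x, ~ H x -> c <= x 0 i0) ->
  measurable (H : set (lebesgueType R n)).
Proof.
move=> Hle Hge; apply: le_caratheodory_measurable => A.
apply: le_ereal_inf_tmp => _ [Q QA <-].
pose L k : E * E := ((Q k).1,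
  \row_i (if i == i0 then Num.min ((Q k).2 0 i) c else (Q k).2 0 i)).
pose U k : E * E :=
  (\row_i (if i == i0 then Num.max ((Q k).1 0 i) c else (Q k).1 0 i), (Q k).2).
have vE k : box_volume (Q k) = box_volume (L k) + box_volume (U k).
  have volE (q : E * E) : box_volume q = Num.max 0 (q.2 0 i0 - q.1 0 i0) *
      \prod_(i < n.+1 | i != i0) Num.max 0 (q.2 0 i - q.1 0 i).
    by rewrite /box_volume (bigD1 i0).
  rewrite (volE (Q k)) (volE (L k)) (volE (U k)).
  have eL : \prod_(i < n.+1 | i != i0) Num.max 0 ((L k).2 0 i - (L k).1 0 i) =
            \prod_(i < n.+1 | i != i0) Num.max 0 ((Q k).2 0 i - (Q k).1 0 i).
    by apply: eq_bigr => i /negbTE ii0; rewrite mxE ii0.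
  have eU : \prod_(i < n.+1 | i != i0) Num.max 0 ((U k).2 0 i - (U k).1 0 i) =
            \prod_(i < n.+1 | i != i0) Num.max 0 ((Q k).2 0 i - (Q k).1 0 i).
    by apply: eq_bigr => i /negbTE ii0; rewrite mxE ii0.
  rewrite eL eU -mulrDl !mxE eqxx; congr (_ * _).
  move: ((Q k).1 0 i0) ((Q k).2 0 i0) => a b.
  rewrite /Num.max /Num.min.
  by case: (ltP b c) => ?; case: (ltP a c) => ?;
    do 3?[case: ltP; rewrite ?subr_gt0 ?subr_le0 => ?]; lra.
under eq_eseriesr do rewrite vE EFinD.
rewrite nneseriesD//; last 2 first.
- by move=> k _; rewrite lee_fin box_volume_ge0.
- by move=> k _; rewrite lee_fin box_volume_ge0.
apply: leeD; apply: ereal_inf_lbound.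
- exists L => // x [Ax Hx]; have [k _ Qx] := QA _ Ax; exists k => // i.
  rewrite mxE/=; case: eqP => [->|_]; last exact: Qx.
  by have /andP[-> h] := Qx i0; rewrite le_min h Hle.
- exists U => // x [Ax Hx]; have [k _ Qx] := QA _ Ax; exists k => // i.
  rewrite mxE/=; case: eqP => [->|_]; last exact: Qx.
  by have /andP[h ->] := Qx i0; rewrite ge_max h Hge.
Qed.

Lemma box_lebesgue_measurable (q : E * E) :
  measurable (box q : set (lebesgueType R n)).
Proof.
have -> : box q = \bigcap_(i in [set: 'I_n.+1])
    ([set x | x 0 i <= q.2 0 i] `&` ~` [set x | x 0 i < q.1 0 i]).
  apply/seteqP; split => [x qx i _ /=|x qx i].
    by have /andP[h ?] := qx i; split => //; apply/negP; rewrite -leNgt.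
  by have [/= -> /negP] := qx i I; rewrite -leNgt => ->.
apply: fin_bigcap_measurable => // i _; apply: measurableI.
  apply: (@halfspace_lebesgue_measurable i (q.2 0 i)) => x //= /negP.
  by rewrite -ltNge => /ltW.
apply: measurableC.
apply: (@halfspace_lebesgue_measurable i (q.1 0 i)) => x /=; first exact: ltW.
by move=> /negP; rewrite -leNgt.
Qed.

Lemma open_lebesgue_measurable (A : set E) :
  open A -> measurable (A : set (lebesgueType R n)).
Proof.
move=> oA.
pose rb (q : 'rV[rat]_n.+1 * 'rV[rat]_n.+1) : E * E :=
  (map_mx ratr q.1, map_mx ratr q.2).
have -> : A = \bigcup_(q in [set: 'rV[rat]_n.+1 * 'rV[rat]_n.+1])
    (if pselect (box (rb q) `<=` A) then box (rb q) else set0).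
  apply/seteqP; split => [x Ax|x [q _]]; last by case: pselect => // h /h.
  have /nbhs_ballP[e /= e0 xeA] := open_nbhs_nbhs (conj oA Ax).
  have /choice[a ha] : forall i, exists y : rat, x 0 i - e < ratr y < x 0 i.
    move=> i; have [|y] := @rat_in_itvoo R (x 0 i - e) (x 0 i).
      by rewrite ltrBlDr ltrDl.
    by rewrite in_itv; exists y.
  have /choice[b hb] : forall i, exists y : rat, x 0 i < ratr y < x 0 i + e.
    move=> i; have [|y] := @rat_in_itvoo R (x 0 i) (x 0 i + e).
      by rewrite ltrDl.
    by rewrite in_itv; exists y.
  exists (\row_i a i, \row_i b i) => //; case: pselect => [_ i|[]].
    rewrite !mxE; have /andP[_ /ltW->] := ha i.
    by have /andP[/ltW-> _] := hb i.
  move=> y hy; apply: xeA; split=> // i j; rewrite (ord1 i).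
  have := hy j; rewrite !mxE => /andP[h1 h2].
  have /andP[h3 _] := ha j; have /andP[_ h4] := hb j.
  by rewrite /ball/= ltr_norml; apply/andP; split; lra.
apply: countable_bigcupT_measurable; first exact: countableP.
by move=> q; case: pselect => h /=; [exact: box_lebesgue_measurable|].
Qed.

End lebesgue_measurable_open.

(* [LspaceType mu p1] is the library's quotient L^p space, which comes without
   algebraic structure; it is given here its normed module structure, all
   operations being those of representatives modulo almost-everywhere
   equality. *)
Section Lspace_normedModType.
Context d (T : measurableType d) (R : realType).
Variables (mu : {measure set T -> \bar R}) (p : \bar R) (p1 : (1 <= p)%E).
Local Notation L := (LspaceType mu p1).
Local Notation F := (LfunType mu p1).
Implicit Types (f g h : L) (u v : F) (a : R).

HB.instance Definition _ := gen_eqMixin L.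
HB.instance Definition _ := gen_choiceMixin L.

Lemma Lnorm_ae_eq (f g : T -> R) :
  measurable_fun [set: T] f -> measurable_fun [set: T] g ->
  f = g %[ae mu] ->
  Lnorm mu p (EFin \o f) = Lnorm mu p (EFin \o g).
Proof.
have mpow r (h : T -> R) : measurable_fun [set: T] h ->
    measurable_fun [set: T] (fun x => `|(h x)%:E| `^ r)%E.
  move=> mh; apply: (measurableT_comp (measurable_poweR _)) => //.
  exact/measurableT_comp/measurable_EFinP.
move=> mf mg fg; rewrite unlock; case: p p1 => [r _|_|h].
- congr (_ `^ _)%E; apply: ge0_ae_eq_integral.
  + exact: measurableT.
  + exact: mpow.
  + exact: mpow.
  + by move=> x _; exact: poweR_ge0.
  + by move=> x _; exact: poweR_ge0.
  + by apply: filterS fg => x /= fgx _; rewrite fgx.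
- case: ifPn => // _; apply: eq_ess_sup.
  by apply: filterS fg => x /= ->.
- by have := lt_le_trans (ltNyr 1) h; rewrite ltxx.
Qed.

Lemma Lspace_measurable f : measurable_fun [set: T] (f : T -> R).
Proof.
exact: (measurable_funPT (repr (f : {mfun_ mu, T >-> measurableTypeR R}))).
Qed.

Lemma Lspace_aeP f g : (f : T -> R) = g %[ae mu] -> f = g.
Proof.
case: f g => [f [[ff]]] [g [[fg]]] /= fg_ae.
have fgE : f = g.
  rewrite -[f]reprK -[g]reprK; apply/eqP.
  exact/ae_eqP.
by subst g; rewrite (Prop_irrelevance ff fg).
Qed.

Definition Lfun_mfun u : {mfun T >-> measurableTypeR R} :=
  HB.pack (u : T -> measurableTypeR R)
    (isMeasurableFun.Build d _ T (measurableTypeR R) u (measurable_funPT u)).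

Definition Lclass_mfun u : {mfun_ mu, T >-> measurableTypeR R} :=
  (\pi_({mfun_ mu, T >-> measurableTypeR R}) (Lfun_mfun u))%qT.

Lemma Lclass_mfun_ae u : (Lclass_mfun u : T -> R) = u %[ae mu].
Proof.
have /eqP := reprK (Lclass_mfun u).
by rewrite [X in _ == X]/Lclass_mfun eqmodE => /asboolP.
Qed.

Lemma Lclass_mfun_finite u : finite_norm mu p (Lclass_mfun u : T -> R).
Proof.
rewrite /finite_norm (Lnorm_ae_eq _ _ (Lclass_mfun_ae u)).
- exact: (Lfunction_finite p1 u).
- exact: (measurable_funPT (repr (Lclass_mfun u))).
- exact: measurable_funPT.
Qed.

HB.instance Definition _ u :=
  isFinLebesgue.Build d T R mu p p1 (Lclass_mfun u) (Lclass_mfun_finite u).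

Definition Lclass u : L := Lclass_mfun u.

Lemma Lclass_ae u : (Lclass u : T -> R) = u %[ae mu].
Proof. exact: Lclass_mfun_ae. Qed.

Lemma Lclass_eq u v : (u : T -> R) = v %[ae mu] -> Lclass u = Lclass v.
Proof.
move=> uv; apply: Lspace_aeP.
apply: ae_eq_trans (Lclass_ae u) _; apply: ae_eq_trans uv _.
exact/ae_eq_sym/Lclass_ae.
Qed.

Lemma Lspace_Lfun f : (f : T -> R) \in Lfun mu p.
Proof.
rewrite inE; apply/andP; split; rewrite inE /=.
  exact: Lspace_measurable.
exact: (@Lebesgue_finite _ _ _ _ _ p1 f).
Qed.

Definition Lrep f : F := Lfun_Sub p1 (Lspace_Lfun f).

Lemma LrepK : cancel Lrep Lclass.
Proof. by move=> f; apply: Lspace_aeP; exact: Lclass_ae. Qed.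

Let zero : L := Lclass 0.
Let opp f : L := Lclass (- Lrep f).
Let add f g : L := Lclass (Lrep f + Lrep g).
Let scale a f : L := Lclass (a *: Lrep f).

Lemma Lrep_ae u : (Lrep (Lclass u) : T -> R) = u %[ae mu].
Proof. exact: Lclass_ae. Qed.

Let LclassN u : opp (Lclass u) = Lclass (- u).
Proof.
apply: Lclass_eq; apply: filterS (Lrep_ae u) => x + _ => /(_ I) ux.
exact: (congr1 -%R ux).
Qed.

Let LclassD u v : add (Lclass u) (Lclass v) = Lclass (u + v).
Proof.
apply: Lclass_eq; apply: filterS2 (Lrep_ae u) (Lrep_ae v) => x.
by move=> /(_ I) ux /(_ I) vx _; exact: (congr2 +%R ux vx).
Qed.

Let LclassZ a u : scale a (Lclass u) = Lclass (a *: u).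
Proof.
apply: Lclass_eq; apply: filterS (Lrep_ae u) => x + _ => /(_ I) ux.
exact: (congr1 ( *%R a) ux).
Qed.

Let addA : associative add.
Proof.
by move=> f g h; rewrite -(LrepK f) -(LrepK g) -(LrepK h) !LclassD addrA.
Qed.

Let addC : commutative add.
Proof. by move=> f g; rewrite /add addrC. Qed.

Let add0 : left_id zero add.
Proof. by move=> f; rewrite -(LrepK f) LclassD add0r. Qed.

Let addN : left_inverse zero opp add.
Proof. by move=> f; rewrite -(LrepK f) LclassN LclassD addNr. Qed.

HB.instance Definition _ := GRing.isZmodule.Build L addA addC add0 addN.

Let scaleA a b f : scale a (scale b f) = scale (a * b) f.
Proof. by rewrite -(LrepK f) !LclassZ scalerA. Qed.

Let scale1 : left_id 1 scale.
Proof. by move=> f; rewrite -(LrepK f) !LclassZ scale1r. Qed.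

Let scaleDr : right_distributive scale +%R.
Proof.
move=> a f g; rewrite -(LrepK f) -(LrepK g) [X in scale a X]LclassD.
by rewrite !LclassZ [RHS]LclassD scalerDr.
Qed.

Let scaleDl f : {morph scale^~ f : a b / a + b}.
Proof.
by move=> a b; rewrite -(LrepK f) !LclassZ [RHS]LclassD scalerDl.
Qed.

HB.instance Definition _ :=
  GRing.Zmodule_isLmodule.Build R L scaleA scale1 scaleDr scaleDl.

Lemma LspaceDE f g : (f + g : T -> R) = (f : T -> R) \+ g %[ae mu].
Proof. exact: Lclass_ae. Qed.

Lemma LspaceNE f : (- f : T -> R) = \- (f : T -> R) %[ae mu].
Proof. exact: Lclass_ae. Qed.

Lemma LspaceZE a f : (a *: f : T -> R) = a \*: (f : T -> R) %[ae mu].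
Proof. exact: Lclass_ae. Qed.

Let norm f : R := fine ('N[mu]_p[EFin \o (f : T -> R)])%E.

Let norm_class u : norm (Lclass u) = fine ('N[mu]_p[EFin \o (u : T -> R)])%E.
Proof.
congr fine; apply: Lnorm_ae_eq; last exact: Lclass_ae.
  exact: Lspace_measurable.
exact: measurable_funPT.
Qed.

Let ler_normD f g : norm (f + g) <= norm f + norm g.
Proof. by rewrite norm_class; exact: ler_LnormD. Qed.

Let normrZ a f : norm (a *: f) = `|a| * norm f.
Proof.
rewrite norm_class; apply: EFin_inj.
rewrite [LHS]finite_norm_fine LnormZ EFinM; congr (_ * _)%E.
exact/esym/(finite_norm_fine (Lrep f)).
Qed.

Let normr0_eq0 f : norm f = 0 -> f = 0.
Proof.
move=> /(@fine_Lnormr_eq0 _ _ _ mu p p1 (Lrep f)) f0.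
by rewrite -(LrepK f); exact: Lclass_eq.
Qed.

HB.instance Definition _ := Lmodule_isNormed.Build R L ler_normD normrZ normr0_eq0.

Lemma Lspace_normE f : (`|f|%:E = 'N[mu]_p[EFin \o (f : T -> R)])%E.
Proof. exact: (finite_norm_fine (Lrep f)). Qed.

End Lspace_normedModType.

(* C([-r,0]; H) with the sup norm.  A continuous function on [-r,0] is encoded by
   its extension by 0 to R, so that Leibniz equality is equality on [-r,0]. *)
Section history.
Context {R : realType} (r : R) (H : normedModType R).

Definition is_history : {pred R -> H} := mem [set phi : R -> H |
  {within `[- r, 0], continuous phi} /\
  forall s, ~ `[- r, 0]%classic s -> phi s = 0].

Lemma is_history_submod_closed : submod_closed is_history.
Proof.
split; first by rewrite inE; split=> // ? ?; exact: cvg_cst.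
move=> a f g; rewrite !inE => -[cf f0] [cg g0]; split=> [x|s rs].
  by apply: cvgD; [apply: cvgZr; exact: cf|exact: cg].
by rewrite !fctE f0// g0// scaler0 addr0.
Qed.

HB.instance Definition _ :=
  GRing.isSubmodClosed.Build R (R -> H) is_history is_history_submod_closed.

Record history := History {
  history_fun :> R -> H ;
  historyP : history_fun \in is_history }.

HB.instance Definition _ := [isSub for history_fun].
HB.instance Definition _ := [Choice of history by <:].
HB.instance Definition _ := [SubChoice_isSubLmodule of history by <:].

Implicit Types (f g : history).

Lemma history_continuous f : {within `[- r, 0], continuous f}.
Proof. by have := historyP f; rewrite inE => -[]. Qed.

Lemma history_out f s : ~ `[- r, 0]%classic s -> f s = 0.
Proof. by have := historyP f; rewrite inE => -[_]; exact. Qed.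

Lemma historyE f g : (forall s, `[- r, 0]%classic s -> f s = g s) -> f = g.
Proof.
move=> fg; apply/val_inj/funext => s /=.
by have [/fg//|rs] := pselect (`[- r, 0]%classic s); rewrite !history_out.
Qed.

Let norm f := sup [set `|f s| | s in `[- r, 0]].

Let has_ub f : has_ubound [set `|f s| | s in `[- r, 0]].
Proof.
have /compact_bounded [M [_ hM]] :=
  continuous_compact (@history_continuous f) (@segment_compact _ _ _).
exists (M + 1) => _ [s rs <-]; apply: (hM (M + 1)); first by rewrite ltrDl.
by exists s.
Qed.

Let norm_ge f s : `[- r, 0]%classic s -> `|f s| <= norm f.
Proof. by move=> rs; apply: ub_le_sup => //; exists s. Qed.

Let norm_ge0 f : 0 <= norm f.
Proof.
rewrite /norm.
have [->|/set0P[s rs]] := eqVneq (`[- r, 0]%classic : set R) set0.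
  by rewrite image_set0 sup0.
exact: le_trans (normr_ge0 _) (norm_ge f rs).
Qed.

Let norm_le f M : 0 <= M ->
  (forall s, `[- r, 0]%classic s -> `|f s| <= M) -> norm f <= M.
Proof.
rewrite /norm => M0 fM.
have [->|/set0P[s rs]] := eqVneq (`[- r, 0]%classic : set R) set0.
  by rewrite image_set0 sup0.
by apply: ge_sup => [|_ [t rt <-]]; [exists `|f s|; exists s|exact: fM].
Qed.

Let ler_normD f g : norm (f + g) <= norm f + norm g.
Proof.
apply: norm_le => [|s rs]; first by rewrite addr_ge0.
by apply: le_trans (ler_normD _ _) _; rewrite lerD ?norm_ge.
Qed.

Let normrZ a f : norm (a *: f) = `|a| * norm f.
Proof.
apply/eqP; rewrite eq_le; apply/andP; split.
  apply: norm_le => [|s rs]; first by rewrite mulr_ge0.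
  by rewrite normrZ ler_wpM2l ?norm_ge.
have [->|a0] := eqVneq a 0; first by rewrite normr0 mul0r.
rewrite -ler_pdivlMl ?normr_gt0//; apply: norm_le => [|s rs].
  by rewrite mulr_ge0 ?invr_ge0.
rewrite ler_pdivlMl ?normr_gt0// -normrZ.
exact: (@norm_ge (a *: f)).
Qed.

Let normr0_eq0 f : norm f = 0 -> f = 0.
Proof.
move=> f0; apply: historyE => s rs; apply/eqP.
by rewrite -normr_le0 -f0 norm_ge.
Qed.

HB.instance Definition _ :=
  Lmodule_isNormed.Build R history ler_normD normrZ normr0_eq0.

Lemma history_normE f : `|f| = sup [set `|f s| | s in `[- r, 0]].
Proof. by []. Qed.

(* The segment u_t.  [insubd] yields 0 when u is not continuous on [t-r,t]; see
   [segmentE] for the case of interest. *)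
Definition segment (u : R -> H) (t : R) : history :=
  insubd 0 (fun s => if s \in `[- r, 0]%R then u (t + s) else 0).

Lemma segmentE (u : R -> H) t s :
  {within `[t - r, t], continuous u} -> - r <= s <= 0 ->
  segment u t s = u (t + s).
Proof.
move=> cu rs; have rs' : s \in `[- r, 0]%R by rewrite in_itv.
rewrite /segment insubdK ?rs'// inE.
split=> [|x /negP/negbTE ->//]; apply/subspace_continuousP => x /= rx.
have trx : `[t - r, t]%classic (t + x).
  by move: rx; rewrite /= !in_itv/= => /andP[? ?]; apply/andP; split; lra.
have /subspace_continuousP/(_ _ trx)/cvgrPdist_lt ux := cu.
apply/cvgrPdist_lt => e /ux /nbhs_ballP[d /= d0 hd]; rewrite near_withinE.
apply/nbhs_ballP; exists d => //= y xy ry.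
rewrite /from_subspace rx ry.
apply: hd; first by move: xy; rewrite /ball/= opprD addrACA subrr add0r.
by move: ry; rewrite /= !in_itv/= => /andP[? ?]; apply/andP; split; lra.
Qed.

End history.

Section smooth_bounded_domain.
Context {R : realType} {n : nat}.
Local Notation E := 'rV[R]_n.+1.

(* C^oo on the open set U: all iterated directional derivatives exist and are
   differentiable at every point of U. *)
Definition smooth_on (U : set E) (f : E -> R) : Prop :=
  forall (vs : seq E) (x : E), U x ->
    differentiable (foldr (fun v g => 'D_v g) f vs) x.

(* Near each boundary point, O is the sublevel set of a smooth function with
   nowhere vanishing gradient. *)
Definition smooth_boundary (O : set E) : Prop :=
  forall x, closure O x -> ~ O x ->
    exists (U : set E) (rho : E -> R),
      [/\ open U, U x, smooth_on U rho,
          forall y, U y -> exists v, 'D_v rho y != 0 &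
          O `&` U = [set y | U y /\ rho y < 0]].

Record smooth_bounded_domain := SmoothBoundedDomain {
  domain_set :> set E ;
  domain_open : open domain_set ;
  domain_neq0 : domain_set !=set0 ;
  domain_connected : connected domain_set ;
  domain_bounded : bounded_set domain_set ;
  domain_smooth : smooth_boundary domain_set }.

End smooth_bounded_domain.
Arguments smooth_bounded_domain : clear implicits.
Arguments domain_open {R n} s.

Section L2.
Context {R : realType} {n : nat} (Omega : smooth_bounded_domain R n).

Definition lebesgue_on : {measure set (lebesgueType R n) -> \bar R} :=
  mrestr (@lebesgue_rV R n)
    (open_lebesgue_measurable (domain_open Omega)).

Definition L2 : normedModType R := LspaceType2 lebesgue_on.

End L2.

(* Unbounded linear operators; the values of [op_fun] outside [op_domain] are
   irrelevant. *)
Record operator (R : realType) (V : lmodType R) := Operator {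
  op_domain : set V ;
  op_fun :> V -> V ;
  op_domain0 : op_domain 0 ;
  op_domain_lin : forall a u v,
    op_domain u -> op_domain v -> op_domain (a *: u + v) ;
  op_linear : forall a u v, op_domain u -> op_domain v ->
    op_fun (a *: u + v) = a *: op_fun u + op_fun v }.

Section operators_L2.
Context d (T : measurableType d) (R : realType).
Variable mu : {measure set T -> \bar R}.
Local Notation H := (LspaceType2 mu).

Definition inner (f g : H) : R := \int[mu]_x (f x * g x).

Implicit Type A : operator H.

Definition densely_defined A : Prop := closure (op_domain A) = [set: H].

(* A^* v = w *)
Definition adjoint_graph A (v w : H) : Prop :=
  forall u, op_domain A u -> inner (A u) v = inner u w.

(* A^* = A, domains included *)
Definition self_adjoint A : Prop :=
  forall v w, adjoint_graph A v w <-> op_domain A v /\ A v = w.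

Definition positive_operator A : Prop :=
  forall u, op_domain A u -> 0 <= inner (A u) u.

End operators_L2.

Section abstract_operators.
Context {R : realType} {V : normedModType R}.
Implicit Type A : operator V.

Definition is_resolvent A (l : R) (Rl : V -> V) : Prop :=
  (forall v, op_domain A (Rl v) /\ l *: Rl v - A (Rl v) = v) /\
  (forall u, op_domain A u -> Rl (l *: u - A u) = u).

Definition compact_map (K : V -> V) : Prop :=
  forall S : set V, bounded_set S -> compact (closure (K @` S)).

Definition compact_resolvent A : Prop :=
  exists (l : R) (Rl : V -> V), is_resolvent A l Rl /\ compact_map Rl.

Definition C0_semigroup (S : R -> V -> V) : Prop :=
  [/\ forall t, 0 <= t -> linear (S t) /\ continuous (S t),
      forall v, S 0 v = v,
      forall s t v, 0 <= s -> 0 <= t -> S (s + t) v = S s (S t v) &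
      forall v, S t v @[t --> 0^'+] --> v].

(* S t = e^(-At): the C0-semigroup whose infinitesimal generator is -A. *)
Definition semigroup_generated_by_opp A (S : R -> V -> V) : Prop :=
  C0_semigroup S /\
  forall v w, h^-1 *: (S h v - v) @[h --> 0^'+] --> w <->
    op_domain A v /\ w = - A v.

(* I is the Riemann integral of f on [a,b], in norm, over tagged partitions
   x 0 <= xi 0 <= x 1 <= ... <= x N of mesh less than delta. *)
Definition is_Riemann_integral (f : R -> V) (a b : R) (I : V) : Prop :=
  forall eps, 0 < eps -> exists2 delta, 0 < delta &
    forall (N : nat) (x xi : nat -> R),
      x 0%N = a -> x N = b ->
      (forall i, (i < N)%N ->
         x i <= xi i <= x i.+1 /\ x i.+1 - x i < delta) ->
      `|\sum_(i < N) (x i.+1 - x i) *: f (xi i) - I| < eps.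

End abstract_operators.

Section delay_equation.
Context {R : realType} {H : normedModType R}.
Variable r : R.
Local Notation C := (history r H).

Definition delay_term (B : H -> H) (eta : C -> R) (phi : C) : H :=
  B (phi (- eta phi)).

Variables (expA : R -> H -> H) (d : R) (F : C -> H).

(* expA t stands for e^(-At). *)
Definition mild_solution (phi : C) (T : R) (u : R -> H) : Prop :=
  [/\ {within `[- r, T], continuous u},
      forall s, - r <= s <= 0 -> u s = phi s &
      forall t, 0 <= t <= T ->
        exists2 I, is_Riemann_integral
            (fun s => expA (t - s) (F (segment r u s) - d *: u s)) 0 t I &
          u t = expA t (phi 0) + I].

Definition global_mild_solution (phi : C) (u : R -> H) : Prop :=
  {within `[- r, +oo[, continuous u} /\
  forall T, 0 < T -> mild_solution phi T u.

End delay_equation.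

Definition dynamical_system (R : realType) (C : normedModType R)
    (S : R -> C -> C) : Prop :=
  [/\ forall phi, S 0 phi = phi,
      forall t tau, 0 <= t -> 0 <= tau ->
        forall phi, S t (S tau phi) = S (t + tau) phi,
      forall phi, {within `[0, +oo[, continuous (fun t => S t phi)} &
      forall t, 0 <= t -> forall (phi_ : nat -> C) (phi : C),
        `|phi_ k - phi| @[k --> \oo] --> (0 : R) ->
        `|S t (phi_ k) - S t phi| @[k --> \oo] --> (0 : R)].

(* Main.v *)
(** Since [Theta_l phi > 0], the number [eta u_t] does not depend, for small
    [t], on the values of [u] after time 0: it can be computed from the constant
      extension of the initial
    function.  On a short interval the equation is thus one with a prescribed
    delay and a Lipschitz right-hand side, solved by Picard iteration.

    Along a given solution [u] the continuous function [Theta_l] has a positive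
    minimum, so [0, T] can be cut into finitely many steps shorter than half of
    it.  During a step the delay of a nearby solution [v] equals that of [u]
    translated vertically by the difference of the two at the start of the
    step, hence is close to that of [u]; a Gronwall estimate then shows that
    [v] stays close to [u].  This yields uniqueness and continuous dependence
    together.

    The linear growth of the right-hand side bounds solutions on [0, T[, which
    therefore have a limit at [T] and can be continued.  The integrals exist
    because L^2 is complete (Riesz-Fischer), and completeness also gives, by
    Banach-Steinhaus, the local boundedness of the semigroup. *)
Require Import Defs.
From HB Require Import structures.
From mathcomp Require Import all_boot all_order all_algebra.
From mathcomp Require Import all_classical all_reals all_analysis.
From mathcomp Require Import measurable_realfun.
From mathcomp Require Import ring lra.
Import Order.TTheory GRing.Theory Num.Theory.
Import numFieldNormedType.Exports.
Local Open Scope classical_set_scope.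
Local Open Scope ring_scope.

Set Implicit Arguments.
Unset Strict Implicit.
Unset Printing Implicit Defensive.


(** * Completeness of L^2 *)

(** The obstacle is that [delay_term] is in general not Lipschitz on the space of histories: two
    nearby histories are evaluated at two different delays, and their difference there involves a
    modulus of continuity, which is not uniform over histories. Moreover [eta] is merely continuous.
    A fixed-point or Gronwall argument therefore does not apply to the equation directly. It becomes
    available because, over a short time, the delay is determined by data that are already known.
    The error in the delay is then measured along the fixed solution [u] alone, whose modulus of
    continuity and compact trajectory are available before the perturbed solution [v] is chosen. The
    thresholds so obtained depend on [u]: the dependence on the initial function is continuous,
    without a Lipschitz rate.

    Paths are extended to the whole line by clamping their argument with [Num.max] and [Num.min], so
    that most of the work deals with ordinary continuity and not with subspace topologies. *)

Section L2_complete.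
Context d (T : measurableType d) (R : realType).
Variable mu : {measure set T -> \bar R}.
Local Notation H := (LspaceType2 mu).
Implicit Types f g : H.

Lemma Lnorm2_sqr (f : T -> R) :
  ('N[mu]_2%:E[EFin \o f] `^ 2 = \int[mu]_x ((f x) ^+ 2)%:E)%E.
Proof.
rewrite powR_Lnorm//; apply: eq_integral => x _.
by rewrite abse_EFin poweR_EFin powR_mulrn// real_normK ?num_real.
Qed.

Lemma L2_norm_sqr f : (`|f| ^+ 2)%:E = (\int[mu]_x ((f x) ^+ 2)%:E)%E.
Proof.
by rewrite -Lnorm2_sqr -Lspace_normE poweR_EFin powR_mulrn.
Qed.

Lemma L2_norm_sqrB f g :
  (`|f - g| ^+ 2)%:E = (\int[mu]_x ((f x - g x) ^+ 2)%:E)%E.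
Proof.
rewrite L2_norm_sqr; apply: ge0_ae_eq_integral => //.
- by apply/measurable_EFinP/measurable_funX/Lspace_measurable.
- apply/measurable_EFinP/measurable_funX/measurable_funB;
    exact: Lspace_measurable.
- by move=> x _; rewrite lee_fin sqr_ge0.
- by move=> x _; rewrite lee_fin sqr_ge0.
apply: filterS2 (LspaceDE f (- g)) (LspaceNE g) => x.
by move=> /(_ I) /= -> /(_ I) /= ->.
Qed.

Lemma L2_class (h : T -> R) : measurable_fun [set: T] h ->
  (\int[mu]_x ((h x) ^+ 2)%:E < +oo)%E ->
  exists f : H, (f : T -> R) = h %[ae mu].
Proof.
move=> mh hoo; have hL : h \in Lfun mu 2%:E.
  rewrite inE; apply/andP; split; rewrite inE//= /finite_norm.
  by apply: (@lty_poweRy _ _ 2) => //; rewrite Lnorm2_sqr.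
by exists (Lclass (Lfun_Sub (lee1n 2) hL)); exact: Lclass_ae.
Qed.

(* The series of [4 ^ n * (f n.+1 - f n) ^ 2] is integrable, so that almost
   everywhere the increments are O(2 ^ -n). *)
Lemma L2_geometric_ae_cvg (f : nat -> H) :
  (forall n, `|f n.+1 - f n| <= 4^-1 ^+ n) ->
  {ae mu, forall x, cvgn (fun n => f n x)}.
Proof.
move=> df.
pose a n x : \bar R := ((4 ^+ n * (f n.+1 x - f n x) ^+ 2)%:E)%E.
have ma n : measurable_fun setT (a n).
  apply/measurable_EFinP/measurable_funM => //.
  apply/measurable_funX/measurable_funB; exact: Lspace_measurable.
have a0 n x : (0 <= a n x)%E.
  by rewrite lee_fin; apply: mulr_ge0; [exact: exprn_ge0|exact: sqr_ge0].
have ia : mu.-integrable setT (fun x => \sum_(n <oo) a n x)%E.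
  apply/integrableP; split.
    by apply: ge0_emeasurable_sum => // k x _ _; exact: a0.
  under eq_integral do rewrite gee0_abs ?nneseries_ge0//.
  rewrite integral_nneseries//.
  (* The terms are at most [4 ^ n * (4 ^ -n) ^ 2 = 4 ^ -n], hence at most [2 ^ -n], here in the form
     [2 / 2 ^ (n + 1)] of a geometric series with known sum. *)
  apply: (@le_lt_trans _ _ (\sum_(n <oo) (2 / (2 ^ (n + 1))%:R)%:E)%E).
    apply: lee_nneseries => [n _ _|n _]; first exact: integral_ge0.
    under eq_integral do rewrite /a EFinM.
    rewrite ge0_integralZl//; last 2 first.
    - apply/measurable_EFinP/measurable_funX/measurable_funB;
        exact: Lspace_measurable.
    - by move=> x _; rewrite lee_fin sqr_ge0.
    rewrite -L2_norm_sqrB -EFinM lee_fin addn1 expnS natrM natrX.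
    rewrite invfM mulVKf// -exprVn.
    have d0 : 0 <= `|f n.+1 - f n| by [].
    have h : `|f n.+1 - f n| ^+ 2 <= 4^-1 ^+ n * 4^-1 ^+ n.
      by rewrite -expr2 ler_pXn2r// nnegrE ?exprn_ge0 ?invr_ge0.
    apply: (@le_trans _ _ (4 ^+ n * (4^-1 ^+ n * 4^-1 ^+ n))).
      by rewrite ler_wpM2l ?exprn_ge0.
    rewrite mulrA -exprMn mulfV// expr1n mul1r.
    by rewrite lerXn2r ?nnegrE ?invr_ge0// lef_pV2 ?posrE// ler_nat.
  by rewrite (cvg_lim _ (@cvg_geometric_eseries_half R 2 0))// expr0 divr1 ltry.
apply: filterS (integrable_ae measurableT ia) => x /(_ I) sx.
set M := fine (\sum_(n <oo) a n x)%E.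
have aM n : 4 ^+ n * (f n.+1 x - f n x) ^+ 2 <= M.
  rewrite -lee_fin /M fineK//.
  apply: le_trans (@nneseries_lim_ge _ (a^~ x) xpredT 0%N n.+1 _) => //.
  rewrite big_nat_recr//= leeDr// sume_ge0// => k _; exact: a0.
have M0 : 0 <= M by apply: le_trans (aM 0%N);
  exact: mulr_ge0 (exprn_ge0 _ _) (sqr_ge0 _).
have dM n : `|f n.+1 x - f n x| <= geometric (Num.sqrt M) 2^-1 n.
  rewrite /geometric/= -(@ler_pXn2r _ 2%N)// ?nnegrE ?mulr_ge0 ?exprn_ge0//.
  rewrite real_normK ?num_real// exprMn sqr_sqrtr// exprVn exprVn.
  rewrite ler_pdivlMr ?exprn_gt0// mulrC -exprM mulnC exprM.
  by have -> : (2:R) ^+ 2 = 4 by ring.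
have : cvgn (series (telescope (f^~ x))).
  apply: normed_cvg; apply: series_le_cvg (is_cvg_geometric_series _).
  - by move=> n; rewrite normr_ge0.
  - by move=> n; apply: le_trans (dM n).
  - exact: dM.
  - by rewrite ger0_norm ?invr_ge0// invf_lt1// ltr1n.
rewrite telescopeK => h.
have -> : (fun n => f n x) = [sequence f n x - f 0%N x]_n + cst (f 0%N x).
  by apply/funext => n; rewrite fctE/= subrK.
exact: is_cvgD h (is_cvg_cst _).
Qed.

Let quarterX_ge0 n : 0 <= (4^-1 : R) ^+ n.
Proof. by rewrite exprn_ge0// invr_ge0. Qed.

Let quarterX2_ge0 n : 0 <= 2 * (4^-1 : R) ^+ n.
Proof. by rewrite mulr_ge0. Qed.

(** Riesz-Fischer for a fast sequence. The limit is defined as an upper limit, which makes it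
    measurable everywhere, and Fatou's lemma carries the estimate between [f m] and [f n] over to
    the limit in [m]. *)
Lemma L2_geometric_cvg (f : nat -> H) :
  (forall n, `|f n.+1 - f n| <= 4^-1 ^+ n) ->
  exists g : H, forall n, `|g - f n| <= 2 * 4^-1 ^+ n.
Proof.
move=> df.
have dfm n m : `|f (n + m)%N - f n| <= 2 * 4^-1 ^+ n.
  (* The factor [1 - 4^-1 ^+ m] strengthens the bound so that the induction on [m] closes. *)
  suff : `|f (n + m)%N - f n| <= 2 * 4^-1 ^+ n * (1 - 4^-1 ^+ m).
    move=> /le_trans; apply; by rewrite ler_piMr ?quarterX2_ge0//.
  elim: m => [|m ih]; first by rewrite addn0 subrr normr0 expr0 subrr mulr0.
  rewrite addnS -(subrKA (f (n + m)%N)) (le_trans (ler_normD _ _))//.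
  apply: le_trans (lerD (df _) ih) _; rewrite exprS exprD.
  have := quarterX_ge0 n; have := quarterX_ge0 m.
  set p := _ ^+ m => p0; set q := _ ^+ n => q0.
  have := mulr_ge0 p0 q0; lra.
have mf n : measurable_fun setT (f n : T -> R) by exact: Lspace_measurable.
pose g x : R := fine (limn_esup (fun n => (f n x)%:E)).
have mg : measurable_fun setT g.
  apply: (measurableT_comp (fine_measurable _)) => //.
  by apply: measurable_fun_limn_esup => n; exact/measurable_EFinP.
have fg : {ae mu, forall x, f n x @[n --> \oo] --> g x}.
  apply: filterS (L2_geometric_ae_cvg df) => x fx.
  suff -> : g x = limn (fun n => f n x) by [].
  have h : (f n x)%:E @[n --> \oo] --> (limn (fun n => f n x))%:E.
    by apply: cvg_EFin; [exact: nearW|exact: fx].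
  by rewrite /g (cvg_limn_einf_sup h).2.
have gf n : (\int[mu]_x ((g x - f n x) ^+ 2)%:E <= ((2 * 4^-1 ^+ n) ^+ 2)%:E)%E.
  have -> : (\int[mu]_x ((g x - f n x) ^+ 2)%:E =
      \int[mu]_x limn_einf (fun m => ((f m x - f n x) ^+ 2)%:E))%E.
    apply: ge0_ae_eq_integral => //.
    - exact/measurable_EFinP/measurable_funX/measurable_funB.
    - rewrite /limn_einf; apply: measurableT_comp => //.
      apply: measurable_fun_limn_esup => m; apply: measurableT_comp => //.
      exact/measurable_EFinP/measurable_funX/measurable_funB.
    - by move=> x _; rewrite lee_fin sqr_ge0.
    - move=> x _; rewrite limn_einf_lim; apply: lime_ge.
        exact: is_cvg_einfs.
      apply: nearW => m; apply: le_ereal_inf_tmp => _ [k _ <-].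
      by rewrite lee_fin sqr_ge0.
    apply: filterS fg => x fx _; apply/esym.
    apply: (cvg_limn_einf_sup _).1; apply: cvg_EFin; first exact: nearW.
    by apply: cvgM; apply: cvgB => //; exact: cvg_cst.
  apply: le_trans (fatou _ _ _ _) _ => //.
  - move=> m; exact/measurable_EFinP/measurable_funX/measurable_funB.
  - by move=> m x _; rewrite lee_fin sqr_ge0.
  rewrite limn_einf_lim; apply: lime_le; first exact: is_cvg_einfs.
  near=> k; apply: (@le_trans _ _ (\int[mu]_x ((f (n + k)%N x - f n x) ^+
    2)%:E)%E).
    by apply: ereal_inf_lbound; exists (n + k)%N => //=; rewrite leq_addl.
  rewrite -L2_norm_sqrB lee_fin ler_pXn2r ?nnegrE ?quarterX2_ge0//.
(* So far only the difference of [g] and [f 0] is known to be square integrable; the class of [g] is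
   obtained by adding [f 0] back. *)
have [h hg] : exists h : H, (h : T -> R) = g %[ae mu].
  have [k kg] : exists k : H, (k : T -> R) = (g \- f 0%N) %[ae mu].
    apply: L2_class; first exact: measurable_funB.
    by apply: le_lt_trans (gf 0%N) _; rewrite ltry.
  exists (k + f 0%N).
  apply: filterS2 kg (LspaceDE k (f 0%N)) => x /(_ I) /= kx /(_ I) /= -> _.
  by rewrite kx subrK.
exists h => n.
rewrite -(@ler_pXn2r _ 2%N)// ?nnegrE ?quarterX2_ge0//.
rewrite -lee_fin L2_norm_sqrB; apply: le_trans (gf n).
rewrite le_eqVlt; apply/orP; left; apply/eqP.
apply: ge0_ae_eq_integral => //.
- apply/measurable_EFinP/measurable_funX/measurable_funB => //.
  exact: Lspace_measurable.
- exact/measurable_EFinP/measurable_funX/measurable_funB.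
- by move=> x _; rewrite lee_fin sqr_ge0.
- by move=> x _; rewrite lee_fin sqr_ge0.
by apply: filterS hg => x /(_ I) ->.
Unshelve. all: end_near. Qed.

Lemma L2_cauchy_cvg (F : set_system H) : ProperFilter F -> cauchy F -> cvg F.
Proof.
move=> PF /cauchyP cF.
(* Consecutive balls meet, since both belong to the filter, and the sum of their radii [4^-n / 2]
   and [4^-(n+1) / 2] stays below [4^-n]. *)
have /choice[f Ff] n : exists f, F (ball f ((4^-1 : R) ^+ n / 2)).
  by apply: cF; rewrite divr_gt0 ?exprn_gt0 ?invr_gt0.
have df n : `|f n.+1 - f n| <= 4^-1 ^+ n.
  have [h []] := filter_ex (filterI (Ff n) (Ff n.+1)).
  rewrite -!ball_normE /= => hn hn1.
  rewrite -(subrKA h); apply: (le_trans (ler_normD _ _)).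
  rewrite [X in _ + X]distrC; apply: le_trans (lerD (ltW hn1) (ltW hn)) _.
  by rewrite exprS; have := quarterX_ge0 n; lra.
have [g gf] := L2_geometric_cvg df.
apply/cvg_ex; exists g; apply/cvgrPdist_lt => e e0.
(* The constant 3 dominates 2, from the distance of [g] to [f n], plus 1/2, from the radius of the
   ball. *)
have [n _ ne] : \forall n \near \oo, `|0 - geometric (3 : R) 4^-1 n| < e.
  have /cvgrPdist_lt : geometric (3 : R) 4^-1 @ \oo --> 0.
    by apply: cvg_geometric; rewrite ger0_norm ?invr_ge0// invf_lt1// ltr1n.
  exact.
apply: filterS (Ff n) => h; rewrite -ball_normE/= => hn.
rewrite -(subrKA (f n)); apply: (le_lt_trans (ler_normD _ _)).
apply: le_lt_trans (lerD (gf n) (ltW hn)) _.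
have := ne n (leqnn n); rewrite sub0r normrN ger0_norm ?mulr_ge0//=.
by have := quarterX_ge0 n; lra.
Qed.

HB.instance Definition _ :=
  Uniform_isComplete.Build (LspaceType mu (lee1n 2)) L2_cauchy_cvg.

End L2_complete.

(** * The Riemann integral of a continuous vector-valued function *)

(** The point [y] ranges over the whole space and not only over [K]: this is applied to perturbed
    histories, which are close to a compact trajectory without lying on it. *)
Lemma compact_unif_continuous (R : realType) (X Y : normedModType R)
    (g : X -> Y) (K : set X) (e : R) : compact K -> continuous g -> 0 < e ->
  exists2 rho, 0 < rho &
    forall k y, K k -> `|y - k| < rho -> `|g y - g k| < e.
Proof.
move=> /compact_near_coveringP cK cg e0.
have : \forall rho \near 0^'+,
    K `<=` [set k | forall y, `|y - k| < rho -> `|g y - g k| < e].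
  apply: cK => x Kx.
  have /cvgrPdist_lt/(_ (e / 2)) := cg x; rewrite divr_gt0// => /(_ isT).
  move=> /nbhs_ballP[h /= h0 hx].
  have gh y : `|x - y| < h -> `|g x - g y| < e / 2.
    by move=> xy; apply: hx; rewrite -ball_normE.
  exists (ball x (h / 2), [set rho | rho < h / 2]).
    split => /=; first by apply: nbhsx_ballx; rewrite divr_gt0.
    by apply: nbhs_right_lt; rewrite divr_gt0.
  move=> [k rho] /= [] /=; rewrite -ball_normE/= => xk rhoh y yk.
  rewrite -(subrKA (g x)) (le_lt_trans (ler_normD _ _))//.
  rewrite [ltRHS]splitr ltrD//; last by apply: gh; lra.
  rewrite distrC gh// -(subrKA k) (le_lt_trans (ler_normD _ _))//.
  by rewrite [X in _ + X]distrC; lra.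
move=> cov; have [rho [h rho0]] := filter_ex (filterI cov (nbhs_right_gt 0)).
by exists rho => // k y Kk; exact: h.
Qed.

Section overlap.
Context {R : realType}.
Implicit Types x y : R.

(* The length of the intersection of [x, x'] and [y, y']. *)
Definition overlap x x' y y' :=
  Num.max y (Num.min x' y') - Num.max y (Num.min x y').

Local Ltac cases :=
  rewrite /overlap /Num.min; repeat (case: ltP => ?);
  rewrite /Num.max; repeat (case: ltP => ?); lra.

Lemma overlapC x x' y y' : x <= x' -> y <= y' ->
  overlap x x' y y' = overlap y y' x x'.
Proof. move=> *; cases. Qed.

Lemma overlap_ge0 x x' y y' : x <= x' -> y <= y' -> 0 <= overlap x x' y y'.
Proof. by move=> *; rewrite subr_ge0 le_max2 ?le_min2. Qed.

Lemma overlap_disjoint x x' y y' : x <= x' -> y <= y' ->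
  x' <= y \/ y' <= x -> overlap x x' y y' = 0.
Proof. by move=> ? ? []?; cases. Qed.

(** [overlap] is the increment of the retraction [c] of the line onto [[y, y']], so the sum
    telescopes. *)
Lemma sum_overlap N (x : nat -> R) y y' : x 0%N <= y -> y <= y' -> y' <= x N ->
  \sum_(i < N) overlap (x i) (x i.+1) y y' = y' - y.
Proof.
move=> x0 yy' xN; pose c s := Num.max y (Num.min s y').
have := @telescope_sumr _ 0 N (c \o x) (leq0n N).
rewrite big_mkord /= => ->.
rewrite /c (min_idPr xN) (max_idPr yy'); congr (_ - _).
by rewrite max_l// ge_min x0.
Qed.

End overlap.

Section riemann_integral.
Context {R : realType}.
Implicit Types (a b c : R).

Definition tagged_partition a b delta N (x xi : nat -> R) : Prop :=
  [/\ x 0%N = a, x N = b & forall i, (i < N)%N ->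
     x i <= xi i <= x i.+1 /\ x i.+1 - x i < delta].

Lemma tagged_partition_mono a b delta N x xi :
  tagged_partition a b delta N x xi ->
  forall i j, (i <= j)%N -> (j <= N)%N -> x i <= x j.
Proof.
move=> [_ _ h] i j ij; rewrite -(subnKC ij); elim: (j - i)%N => [|k ih] kN.
  by rewrite addn0.
move: kN; rewrite addnS => kN.
by have [/andP[u v] _] := h _ kN; apply: le_trans (ih (ltnW kN)) (le_trans u v).
Qed.

Lemma tagged_partition_mem a b delta N x xi :
  tagged_partition a b delta N x xi ->
  forall i, (i < N)%N -> a <= x i /\ x i.+1 <= b.
Proof.
move=> h i iN; have := tagged_partition_mono h; have [<- <- _] := h => m.
by split; apply: m => //; exact: ltnW.
Qed.

Lemma tagged_partition_length a b delta N x xi :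
  tagged_partition a b delta N x xi -> \sum_(i < N) (x i.+1 - x i) = b - a.
Proof.
move=> [<- <- _]; rewrite -(big_mkord xpredT (fun i => x i.+1 - x i)).
by rewrite telescope_sumr.
Qed.

Lemma uniform_partition a b delta : a <= b -> 0 < delta ->
  exists N x xi, tagged_partition a b delta N x xi.
Proof.
move=> ab d0; have [N hN] : exists N : nat, b - a < delta * N.+1%:R.
  exists (Num.truncn ((b - a) / delta)); rewrite mulrC -ltr_pdivrMr//.
  by apply: truncnS_gt.
pose x (i : nat) := a + (b - a) * (i%:R / N.+1%:R); exists N.+1, x, x.
have xS i : x i.+1 - x i = (b - a) / N.+1%:R.
  by rewrite /x -(natr1 i); move: (N.+1%:R^-1) => q; ring.
split=> [||i _]; first by rewrite /x mul0r mulr0 addr0.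
  by rewrite /x divff ?pnatr_eq0// mulr1 addrCA subrr addr0.
rewrite xS ltr_pdivrMr// lexx/= -subr_ge0 xS; split => //.
by rewrite divr_ge0 ?subr_ge0.
Qed.

Section sums.
Context {V : normedModType R}.
Implicit Types (f g : R -> V) (I J : V).

Definition riemann_sum f N (x xi : nat -> R) : V :=
  \sum_(i < N) (x i.+1 - x i) *: f (xi i).

Lemma Riemann_integralP f a b I : is_Riemann_integral f a b I <->
  forall eps, 0 < eps -> exists2 delta, 0 < delta & forall N x xi,
    tagged_partition a b delta N x xi -> `|riemann_sum f N x xi - I| < eps.
Proof.
split=> h eps /h[delta d0 hd]; exists delta => // N x xi.
  by move=> [*]; apply: hd.
by move=> *; apply: hd; split.
Qed.

Lemma tagged_partition_le a b delta delta' N x xi : delta <= delta' ->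
  tagged_partition a b delta N x xi -> tagged_partition a b delta' N x xi.
Proof.
move=> dd [? ? h]; split=> // i /h[? ?]; split=> //; exact: lt_le_trans dd.
Qed.

Lemma riemann_sum_le f a b delta N x xi K :
  tagged_partition a b delta N x xi ->
  (forall s, a <= s <= b -> `|f s| <= K) ->
  `|riemann_sum f N x xi| <= (b - a) * K.
Proof.
move=> P fK; rewrite -(tagged_partition_length P) mulr_suml.
apply: le_trans (ler_norm_sum _ _ _) _; apply: ler_sum => i _.
have [u v] := tagged_partition_mem P (ltn_ord i).
have [_ _ /(_ _ (ltn_ord i))[/andP[p q] _]] := P.
rewrite normrZ ger0_norm ?subr_ge0 ?(le_trans p)// ler_wpM2l//.
  by rewrite subr_ge0 (le_trans p).
by apply: fK; rewrite (le_trans u)//= (le_trans q).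
Qed.

Lemma riemann_sum_close f a b delta e N x xi M y zeta :
  tagged_partition a b delta N x xi -> tagged_partition a b delta M y zeta ->
  (forall s t, a <= s <= b -> a <= t <= b -> `|s - t| < delta + delta ->
     `|f s - f t| <= e) ->
  `|riemann_sum f N x xi - riemann_sum f M y zeta| <= (b - a) * e.
Proof.
move=> P Q fe.
have [x0 xN hx] := P; have [y0 yM hy] := Q.
have xx (i : 'I_N) : x i <= x i.+1.
  by have [/andP[p q] _] := hx _ (ltn_ord i); exact: le_trans p q.
have yy (j : 'I_M) : y j <= y j.+1.
  by have [/andP[p q] _] := hy _ (ltn_ord j); exact: le_trans p q.
pose l (i : 'I_N) (j : 'I_M) := overlap (x i) (x i.+1) (y j) (y j.+1).
have lE i : \sum_j l i j = x i.+1 - x i.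
  have [u v] := tagged_partition_mem P (ltn_ord i).
  rewrite -(@sum_overlap _ M y) ?y0 ?yM//.
  by apply: eq_bigr => j _; rewrite /l overlapC.
have lE' j : \sum_i l i j = y j.+1 - y j.
  have [u v] := tagged_partition_mem Q (ltn_ord j).
  by rewrite sum_overlap ?x0 ?xN.
(* Both sums are refined over the intersections of their cells. *)
have -> : riemann_sum f N x xi - riemann_sum f M y zeta =
    \sum_i \sum_j l i j *: (f (xi i) - f (zeta j)).
  under eq_bigr do under eq_bigr do rewrite scalerBr.
  under eq_bigr do rewrite sumrB.
  rewrite sumrB; congr (_ - _).
    by apply: eq_bigr => i _; rewrite -scaler_suml lE.
  by rewrite exchange_big; apply: eq_bigr => j _; rewrite /= -scaler_suml lE'.
rewrite -(tagged_partition_length P) mulr_suml.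
apply: le_trans (ler_norm_sum _ _ _) _; apply: ler_sum => i _.
rewrite -lE mulr_suml.
apply: le_trans (ler_norm_sum _ _ _) _; apply: ler_sum => j _.
have l0 : 0 <= l i j by exact: overlap_ge0.
rewrite normrZ (ger0_norm l0).
(* Only cells of nonzero overlap contribute; such cells meet, so their tags are less than two meshes
   apart. *)
have [lij0|] := eqVneq (l i j) 0; first by rewrite lij0 !mul0r.
move=> lij; apply: ler_wpM2l => //.
have [xy|xy] := leP (x i.+1) (y j).
  by move: lij; rewrite /l overlap_disjoint ?eqxx//; left.
have [yx|yx] := leP (y j.+1) (x i).
  by move: lij; rewrite /l overlap_disjoint ?eqxx//; right.
have [u v] := tagged_partition_mem P (ltn_ord i).
have [u' v'] := tagged_partition_mem Q (ltn_ord j).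
have [/andP[p q] dx] := hx _ (ltn_ord i).
have [/andP[p' q'] dy] := hy _ (ltn_ord j).
apply: fe; [by apply/andP; split; lra|by apply/andP; split; lra|].
by rewrite ltr_norml; apply/andP; split; lra.
Qed.

Lemma Riemann_integral_norm f a b I K : a <= b ->
  is_Riemann_integral f a b I -> (forall s, a <= s <= b -> `|f s| <= K) ->
  `|I| <= (b - a) * K.
Proof.
move=> ab /Riemann_integralP fI fK; apply/ler_addgt0Pl => e /fI[delta d0 h].
have [N [x [xi P]]] := uniform_partition ab d0.
rewrite -(subrK (riemann_sum f N x xi) I) (le_trans (ler_normD _ _))//.
by rewrite lerD ?(riemann_sum_le P)// distrC; exact/ltW/h.
Qed.

Lemma Riemann_integral_lin f g a b I J (k : R) :
  is_Riemann_integral f a b I -> is_Riemann_integral g a b J ->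
  is_Riemann_integral (fun s => f s + k *: g s) a b (I + k *: J).
Proof.
move=> /Riemann_integralP fI /Riemann_integralP gJ; apply/Riemann_integralP.
move=> e e0; have k0 : 0 < `|k| + 1 by rewrite ltr_pwDr.
have [d1 d10 h1] := fI _ (divr_gt0 e0 (ltr0n _ 2)).
have [d2 d20 h2] := gJ _ (divr_gt0 (divr_gt0 e0 (ltr0n _ 2)) k0).
exists (Num.min d1 d2) => [|N x xi P]; first by rewrite lt_min d10.
have -> : riemann_sum (fun s => f s + k *: g s) N x xi =
    riemann_sum f N x xi + k *: riemann_sum g N x xi.
  rewrite /riemann_sum scaler_sumr -big_split; apply: eq_bigr => i _ /=.
  by rewrite scalerDr !scalerA mulrC.
rewrite opprD addrACA -scalerBr (le_lt_trans (ler_normD _ _))//.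
rewrite normrZ [ltRHS]splitr ltr_leD//.
  by apply: h1; apply: tagged_partition_le P; rewrite ge_min lexx.
have P2 : tagged_partition a b d2 N x xi.
  by apply: tagged_partition_le P; rewrite ge_min lexx orbT.
have := ltW (h2 _ _ _ P2); rewrite ler_pdivlMr// => h.
by apply: le_trans h; rewrite mulrC ler_wpM2l// lerDl.
Qed.

Lemma Riemann_integral_unique f a b I J : a <= b ->
  is_Riemann_integral f a b I -> is_Riemann_integral f a b J -> I = J.
Proof.
move=> ab fI fJ; have := Riemann_integral_lin (-1) fI fJ.
move=> /(Riemann_integral_norm (K := 0) ab); rewrite mulr0 scaleN1r => h.
apply/eqP; rewrite -subr_eq0 -normr_le0; apply: h => s _.
by rewrite scaleN1r subrr normr0.
Qed.

Lemma Riemann_integral_ext f g a b I : (forall s, a <= s <= b -> f s = g s) ->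
  is_Riemann_integral f a b I -> is_Riemann_integral g a b I.
Proof.
move=> fg /Riemann_integralP fI; apply/Riemann_integralP => e /fI[delta d0 h].
exists delta => // N x xi P; rewrite (_ : riemann_sum g N x xi =
    riemann_sum f N x xi); first exact: h.
apply: eq_bigr => i _; congr (_ *: _); apply/esym/fg.
have [u v] := tagged_partition_mem P (ltn_ord i).
have [_ _ /(_ _ (ltn_ord i))[/andP[p q] _]] := P.
by apply/andP; split; lra.
Qed.

Lemma Riemann_integral_shift f a b c I :
  is_Riemann_integral f (a + c) (b + c) I ->
  is_Riemann_integral (fun s => f (s + c)) a b I.
Proof.
move=> /Riemann_integralP fI; apply/Riemann_integralP => e /fI[delta d0 h].
exists delta => // N x xi [xa xb xP].
have := h N (fun i => x i + c) (fun i => xi i + c).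
rewrite (_ : riemann_sum _ _ _ _ = riemann_sum (fun s => f (s + c)) N x xi).
  apply; split; [by rewrite xa|by rewrite xb|move=> i /xP].
  by rewrite !lerD2r opprD addrACA subrr addr0.
by apply: eq_bigr => i _; congr (_ *: _); ring.
Qed.

End sums.

Lemma Riemann_integral_linear (V W : normedModType R) (L : V -> W) (f : R -> V)
    a b I (K : R) :
  linear L -> (forall v, `|L v| <= K * `|v|) ->
  is_Riemann_integral f a b I -> is_Riemann_integral (L \o f) a b (L I).
Proof.
move=> linL LK /Riemann_integralP fI; apply/Riemann_integralP => e e0.
pose L' : {linear V -> W} := HB.pack L (GRing.isLinear.Build _ _ _ _ _ linL).
have K0 : 0 < `|K| + 1 by rewrite ltr_pwDr.
have [delta d0 h] := fI _ (divr_gt0 e0 K0).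
exists delta => // N x xi /h.
have -> : riemann_sum (L \o f) N x xi = L (riemann_sum f N x xi).
  rewrite -[L]/(L' : V -> W) linear_sum.
  by apply: eq_bigr => i _; rewrite linearZ.
rewrite -[L]/(L' : V -> W) -linearB ltr_pdivlMr//= => /(le_lt_trans _); apply.
apply: le_trans (LK _) _; rewrite mulrC ler_wpM2l// (le_trans (ler_norm _))//.
by rewrite lerDl.
Qed.

Section complete.
Context {V : completeNormedModType R}.
Implicit Types (f g : R -> V) (I J : V).

Lemma continuous_Riemann_integrable f a b : a <= b -> continuous f ->
  exists I, is_Riemann_integral f a b I.
Proof.
move=> ab cf.
have close (e : R) : 0 < e -> exists2 delta, 0 < delta & forall N x xi M y zeta,
    tagged_partition a b delta N x xi -> tagged_partition a b delta M y zeta ->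
    `|riemann_sum f N x xi - riemann_sum f M y zeta| < e.
  move=> e0; have ba : 0 < b - a + 1 by rewrite ltr_pwDr// subr_ge0.
  have [rho rho0 h] := compact_unif_continuous (@segment_compact R a b) cf
    (divr_gt0 e0 ba).
  exists (rho / 2) => [|N x xi M y zeta P Q]; first by rewrite divr_gt0.
  have := riemann_sum_close (f := f) (e := e / (b - a + 1)) P Q;
    rewrite -splitr.
  move=> /(_ _)/le_lt_trans; apply => [s t sab tab st|].
    by apply/ltW/h => //=; rewrite in_itv.
  by rewrite mulrCA gtr_pMr// ltr_pdivrMr// mul1r ltrDl.
have /choice[P hP] n : exists P : nat * (nat -> R) * (nat -> R),
    tagged_partition a b (n.+1%:R^-1) P.1.1 P.1.2 P.2.
  have [|N [x [xi Px]]] := @uniform_partition a b n.+1%:R^-1 ab.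
    by rewrite invr_gt0.
  by exists (N, x, xi).
pose U n := riemann_sum f (P n).1.1 (P n).1.2 (P n).2.
have small (e : R) : 0 < e -> \forall n \near \oo, n.+1%:R^-1 < e.
  move=> e0; have /cvgrPdist_lt/(_ _ e0) := @cvg_harmonic R.
  by apply: filterS => n; rewrite sub0r normrN gtr0_norm// invr_gt0.
have cU : cvgn U.
  apply/cauchy_cvgP/cauchy_exP => e /close[delta d0 hd].
  have [m _ sd] := small _ d0.
  exists (U m), m => // n /= mn; rewrite -ball_normE /=.
  apply: hd; first by apply: tagged_partition_le (hP m); exact/ltW/sd/leqnn.
  by apply: tagged_partition_le (hP n); exact/ltW/sd.
exists (limn U); apply/Riemann_integralP => e e0.
have e2 : 0 < e / 2 by rewrite divr_gt0.
have [delta d0 hd] := close _ e2; exists delta => // N x xi Q.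
have /cvgrPdist_lt/(_ _ e2) cU' := cU; have sd := small _ d0.
near \oo => n.
rewrite -(subrKA (U n)) (le_lt_trans (ler_normD _ _))//.
rewrite [ltRHS]splitr ltrD//.
  apply: hd => //; apply: tagged_partition_le (hP n); apply/ltW; near: n.
  exact: sd.
by rewrite distrC; near: n.
Unshelve. all: end_near. Qed.

(** Existence over [[a, c]] comes from continuity; the value can then be identified on a single
    partition, the concatenation of fine partitions of the two halves. *)
Lemma Riemann_integral_cat f a b c I J : a <= b -> b <= c -> continuous f ->
  is_Riemann_integral f a b I -> is_Riemann_integral f b c J ->
  is_Riemann_integral f a c (I + J).
Proof.
move=> ab bc cf fI fJ.
have [K fK] := continuous_Riemann_integrable (le_trans ab bc) cf.
suff -> : I + J = K by [].
apply/eqP; rewrite -subr_eq0 -normr_le0; apply/ler_addgt0Pl => e e0.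
rewrite addr0; have e3 : 0 < e / 3 by rewrite divr_gt0.
move: fI fJ fK => /Riemann_integralP/(_ _ e3)[d1 d10 h1].
move=> /Riemann_integralP/(_ _ e3)[d2 d20 h2].
move=> /Riemann_integralP/(_ _ e3)[d3 d30 h3].
have d0 : 0 < Num.min d1 (Num.min d2 d3) by rewrite !lt_min d10 d20.
have [N [x [xi P]]] := uniform_partition ab d0.
have [M [y [zeta Q]]] := uniform_partition bc d0.
have /h1 {}h1 : tagged_partition a b d1 N x xi.
  by apply: tagged_partition_le P; rewrite ge_min lexx.
have /h2 {}h2 : tagged_partition b c d2 M y zeta.
  by apply: tagged_partition_le Q; rewrite !ge_min lexx orbT.
pose z i := if (i <= N)%N then x i else y (i - N)%N.
pose t i := if (i < N)%N then xi i else zeta (i - N)%N.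
have zr i : z (N + i)%N = y i.
  rewrite /z; case: i => [|i]; last first.
    by rewrite -[X in (_ <= X)%N]addn0 leq_add2l addKn.
  by rewrite addn0 leqnn; have [_ -> _] := P; have [-> _ _] := Q.
have tr i : t (N + i)%N = zeta i by rewrite /t ltnNge leq_addr/= addKn.
have zE : riemann_sum f (N + M) z t =
    riemann_sum f N x xi + riemann_sum f M y zeta.
  rewrite /riemann_sum big_split_ord /=; congr (_ + _); apply: eq_bigr => i _.
    by rewrite /z /t ltn_ord ltnW//; exact: ltn_ord.
  by rewrite -addnS !zr tr.
have /h3 : tagged_partition a c d3 (N + M) z t.
  apply: tagged_partition_le (_ : Num.min d1 (Num.min d2 d3) <= _) _.
    by rewrite !ge_min lexx !orbT.
  have [x0 xN hx] := P; have [y0 yM hy] := Q.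
  split=> [||i iNM]; [by rewrite /z leq0n|by rewrite zr|].
  have [iN|Ni] := ltnP i N; first by rewrite /z /t iN ltnW//; exact: hx.
  by rewrite -(subnKC Ni) -addnS !zr tr; apply: hy; rewrite ltn_subLR.
rewrite zE => {}h3.
rewrite -(subrKA (riemann_sum f N x xi + riemann_sum f M y zeta)).
apply: le_trans (ler_normD _ _) _; rewrite opprD addrACA.
have h1' : `|I - riemann_sum f N x xi| < e / 3 by rewrite distrC.
have h2' : `|J - riemann_sum f M y zeta| < e / 3 by rewrite distrC.
by have := ler_normD (I - riemann_sum f N x xi) (J - riemann_sum f M y zeta);
  lra.
Qed.

Definition rintegral f a b : V := xget 0 (is_Riemann_integral f a b).

Lemma rintegralP f a b : a <= b -> continuous f ->
  is_Riemann_integral f a b (rintegral f a b).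
Proof.
move=> ab cf; have [I fI] := continuous_Riemann_integrable ab cf.
exact: (xgetPex 0 (ex_intro _ I fI)).
Qed.

Lemma rintegral_eq f a b I : a <= b -> is_Riemann_integral f a b I ->
  rintegral f a b = I.
Proof.
move=> ab fI; apply: Riemann_integral_unique (fI) => //.
exact: (xgetPex 0 (ex_intro _ I fI)).
Qed.

Lemma rintegral_chasles f a b c : a <= b -> b <= c -> continuous f ->
  rintegral f a c = rintegral f a b + rintegral f b c.
Proof.
move=> ab bc cf; apply: rintegral_eq (le_trans ab bc) _.
apply: (@Riemann_integral_cat f a b) => //; exact: rintegralP.
Qed.

Lemma rintegral_normB f g a b K : a <= b -> continuous f -> continuous g ->
  (forall s, a <= s <= b -> `|f s - g s| <= K) ->
  `|rintegral f a b - rintegral g a b| <= (b - a) * K.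
Proof.
move=> ab cf cg fgK.
have := Riemann_integral_lin (-1) (rintegralP ab cf) (rintegralP ab cg).
rewrite scaleN1r => /(Riemann_integral_norm ab); apply => s /fgK.
by rewrite scaleN1r.
Qed.

Lemma rintegral_norm f a b K : a <= b -> continuous f ->
  (forall s, a <= s <= b -> `|f s| <= K) ->
  `|rintegral f a b| <= (b - a) * K.
Proof. by move=> ab cf; exact/Riemann_integral_norm/rintegralP. Qed.

End complete.
End riemann_integral.

(** * Strongly continuous semigroups *)

Lemma distr_max0 (R : realDomainType) (a b : R) :
  `|Num.max 0 a - Num.max 0 b| <= `|a - b|.
Proof.
have := ler_norm (a - b); have := ler_norm (b - a); rewrite (distrC b).
by rewrite ler_norml /Num.max; case: (ltP 0 a) => ?; case: (ltP 0 b) => ? ? ?;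
  apply/andP; split; lra.
Qed.

Section semigroup.
Context {R : realType} {H : completeNormedModType R} (S : R -> H -> H).
Hypothesis HS : C0_semigroup S.
Implicit Types (t s T : R) (v w : H).

Lemma semigroup_linearP t : 0 <= t -> linear (S t).
Proof. by have [h _ _ _] := HS; move=> /h[]. Qed.

Lemma semigroup0 v : S 0 v = v.
Proof. by have [_ h _ _] := HS. Qed.

Lemma semigroupD s t v : 0 <= s -> 0 <= t -> S (s + t) v = S s (S t v).
Proof. by have [_ _ h _] := HS; exact: h. Qed.

Definition semigroup_linear t (t0 : 0 <= t) : {linear H -> H} :=
  HB.pack (S t) (GRing.isLinear.Build _ _ _ _ _ (semigroup_linearP t0)).

Lemma semigroupB t v w : 0 <= t -> S t (v - w) = S t v - S t w.
Proof. by move=> t0; exact: (linearB (semigroup_linear t0)). Qed.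

Lemma semigroupZ t (k : R) v : 0 <= t -> S t (k *: v) = k *: S t v.
Proof. by move=> t0; rewrite -[S t]/(semigroup_linear t0 : _ -> _) linearZ. Qed.

Lemma semigroup_bounded_fun_norm t : 0 <= t -> bounded_fun_norm (S t).
Proof.
move=> t0; apply: (iffRL (bounded_funP (semigroup_linear t0))).
apply: (iffRL (linear_bounded_continuous (semigroup_linear t0))).
by have [h _ _ _] := HS; have [] := h t t0.
Qed.

Lemma semigroup_cvg0 v e : 0 < e ->
  exists2 delta, 0 < delta & forall t, 0 <= t < delta -> `|S t v - v| < e.
Proof.
move=> e0; have [_ _ _ /(_ v)/cvgrPdist_lt/(_ _ e0)] := HS.
move=> /nbhs_ballP[delta /= d0 h]; exists delta => // t /andP[].
rewrite le_eqVlt => /predU1P[<- _|t0 td]; first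
  by rewrite semigroup0 subrr normr0.
rewrite distrC; apply: h => //.
by rewrite /ball/= sub0r normrN gtr0_norm.
Qed.

(* Otherwise Banach-Steinhaus applies to operators [S (t n)] with [t n] tending
   to 0 and unbounded norms. *)
Lemma semigroup_bound0 : exists2 h, 0 < h & exists2 M, 1 <= M &
  forall t, 0 <= t <= h -> forall v, `|S t v| <= M * `|v|.
Proof.
apply: contrapT => nbound.
have /choice[tv htv] n : exists tv : R * H,
    0 <= tv.1 <= n.+1%:R^-1 /\ n.+1%:R * `|tv.2| < `|S tv.1 tv.2|.
  apply: contrapT => nex; apply: nbound; exists n.+1%:R^-1.
    by rewrite invr_gt0.
  exists n.+1%:R; first by rewrite ler1n.
  move=> t tn v; rewrite leNgt; apply/negP => lt; apply: nex.
  by exists (t, v).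
have t0 n : 0 <= (tv n).1 by have [/andP[]] := htv n.
have /(_ 1)[M hM] : uniform_bounded [set S (tv n).1 | n in setT].
  apply: Banach_Steinhauss => [_ [n _ <-]|v].
    by split; [exact: semigroup_bounded_fun_norm|exact: semigroup_linearP].
  have [delta d0 hd] := semigroup_cvg0 v ltr01.
  pose N := Num.truncn delta^-1.
  (* For [n >= N] the time [(tv n).1] is below [delta], so its operator moves [v] by less than 1;
     the finite sum takes care of the other indices. *)
  exists (`|v| + 1 + \sum_(n < N) `|S (tv n).1 v|) => _ [n _ <-].
  have [nN|Nn] := ltnP n N.
    rewrite (bigD1 (Ordinal nN))//= addrCA lerDl addr_ge0 ?addr_ge0//.
    by rewrite sumr_ge0.
  rewrite ler_wpDr ?sumr_ge0// -(subrK v (S _ v)) addrC.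
  rewrite (le_trans (ler_normD _ _))// lerD2l; apply/ltW/hd; rewrite t0/=.
  have [/andP[_ h] _] := htv n; apply: le_lt_trans h _.
  rewrite invf_plt ?posrE//.
  apply: lt_le_trans (truncnS_gt _) _; rewrite ler_nat ltnS.
  exact: Nn.
(* At this index the operator stretches [(tv n).2] by more than [n.+1 > M], against the uniform
   bound. *)
pose n := Num.truncn M.
have [_ hn] := htv n; have v0 : 0 < `|(tv n).2|.
  rewrite normr_gt0; apply/eqP => v0.
  move: hn; rewrite v0 normr0 mulr0.
  by rewrite -[S _]/(semigroup_linear (t0 n) : _ -> _) linear0 normr0 ltxx.
have := hM _ (imageP _ (I : setT n)) (`|(tv n).2|^-1 *: (tv n).2).
rewrite semigroupZ// !normrZ !normfV !normr_id mulVf ?gt_eqF// => /(_ (lexx _)).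
rewrite ler_pdivrMl// leNgt => /negP; apply; apply: le_lt_trans hn.
by rewrite mulrC ler_wpM2r// ltW// truncnS_gt.
Qed.

(** A time up to [h *+ k] is a sum of [k] times at most [h], which costs the factor [M ^+ k]. *)
Lemma semigroup_bound T : exists2 M, 1 <= M &
  forall t, 0 <= t <= T -> forall v, `|S t v| <= M * `|v|.
Proof.
have [h h0 [M M1 hM]] := semigroup_bound0.
have M0 : 0 <= M by exact: le_trans ler01 M1.
have bound k t v : 0 <= t <= h *+ k -> `|S t v| <= M ^+ k * `|v|.
  elim: k t v => [|k ih] t v.
    by rewrite mulr0n => /le_anti<-; rewrite semigroup0 expr0 mul1r.
  move=> /andP[t0 tk]; pose s := Num.min t h.
  have s0 : 0 <= s by rewrite le_min t0 ltW.
  have st : 0 <= t - s by rewrite subr_ge0 ge_min lexx.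
  rewrite -(subrK s t) addrC semigroupD// exprS -mulrA.
  rewrite (le_trans (hM _ _ _))//; first by rewrite s0 ge_min lexx orbT.
  rewrite ler_wpM2l// ih// st/= lerBlDr /s minEle; case: ifP => _.
    by rewrite lerDr mulrn_wge0// ltW.
  by move: tk; rewrite mulrSr.
exists (M ^+ (Num.truncn (T / h)).+1); first exact: exprn_ege1.
move=> t /andP[t0 tT] v; apply: bound; rewrite t0/= (le_trans tT)//.
by rewrite -mulr_natl -ler_pdivrMr// ltW// truncnS_gt.
Qed.

(** For [b <= c], the difference [S c v - S b v] is [S b] applied to [S (c - b) v - v]. With the
    local bound, right continuity at 0 thus gives continuity from both sides at every time. *)
Lemma semigroup_orbit_continuous v : continuous (fun t => S (Num.max 0 t) v).
Proof.
move=> a; have [M M1 hM] := semigroup_bound (Num.max 0 (a + 1)).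
have M0 : 0 < M by exact: lt_le_trans M1.
have dist b c : 0 <= b -> b <= c -> c <= Num.max 0 (a + 1) ->
    `|S c v - S b v| <= M * `|S (c - b) v - v|.
  move=> b0 bc ca.
  have -> : S c v = S b (S (c - b) v) by rewrite -semigroupD ?subr_ge0//
    addrC subrK.
  by rewrite -semigroupB// hM// b0 (le_trans bc).
apply/cvgrPdist_lt => e e0.
have [delta d0 hd] := semigroup_cvg0 v (divr_gt0 e0 M0).
near=> t.
have ta1 : t < a + 1 by near: t; apply: lt_nbhsl; rewrite ltrDl.
have ta : `|a - t| < delta.
  by near: t; apply/nbhs_ballP; exists delta => //= y; rewrite -ball_normE.
set b := Num.max 0 a; set c := Num.max 0 t.
have bc : `|b - c| < delta.
  exact: le_lt_trans (distr_max0 _ _) ta.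
have b0 : 0 <= b by rewrite le_max lexx.
have c0 : 0 <= c by rewrite le_max lexx.
have ba : b <= Num.max 0 (a + 1) by rewrite le_max2// lerDl.
have ca : c <= Num.max 0 (a + 1) by rewrite le_max2// ltW.
have [cb|cb] := leP c b.
  apply: le_lt_trans (dist _ _ c0 cb ba) _; rewrite -ltr_pdivlMl// mulrC.
  by apply: hd; rewrite subr_ge0 cb/= -(ger0_norm (_ : 0 <= b - c)) ?subr_ge0.
rewrite distrC; apply: le_lt_trans (dist _ _ b0 (ltW cb) ca) _.
rewrite -ltr_pdivlMl// mulrC.
by apply: hd; move: bc; rewrite subr_ge0 (ltW cb) ltr0_norm ?subr_lt0// opprB.
Unshelve. all: end_near. Qed.

(** Joint continuity in time and vector: by the local bound the operators are equicontinuous, so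
    strong continuity extends to a moving vector. *)
Lemma semigroup_cvg (T : Type) (F : set_system T) (FF : Filter F)
    (a : T -> R) (f : T -> H) (a0 : R) (v : H) :
  a x @[x --> F] --> a0 -> f x @[x --> F] --> v ->
  S (Num.max 0 (a x)) (f x) @[x --> F] --> S (Num.max 0 a0) v.
Proof.
move=> aF fF; have [M M1 hM] := semigroup_bound (Num.max 0 (a0 + 1)).
have M0 : 0 < M by exact: lt_le_trans M1.
apply/cvgrPdist_lt => e e0; near=> x.
rewrite -(subrKA (S (Num.max 0 (a x)) v)) (le_lt_trans (ler_normD _ _))//.
rewrite [ltRHS]splitr ltrD//.
  near: x.
  have := @cvg_comp _ _ _ a (fun t => S (Num.max 0 t) v) F _ _ aF
    (@semigroup_orbit_continuous v a0).
  by move=> /cvgrPdist_lt; apply; rewrite divr_gt0.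
rewrite -semigroupB ?le_max ?lexx//.
have ax : 0 <= Num.max 0 (a x) <= Num.max 0 (a0 + 1).
  rewrite le_max lexx/= le_max2//; near: x.
  have /cvgrPdist_lt/(_ _ ltr01) := aF; apply: filterS => x.
  by rewrite ltr_norml; lra.
apply: le_lt_trans (hM _ ax _) _; rewrite -ltr_pdivlMl// mulrC.
by near: x; move/cvgrPdist_lt: fF; apply; rewrite divr_gt0// divr_gt0.
Unshelve. all: end_near. Qed.

End semigroup.

(** * The Duhamel integral *)

Lemma near_distr (R : realType) (a e : R) : 0 < e ->
  \forall t \near a, `|a - t| < e.
Proof. by move=> e0; apply/nbhs_ballP; exists e. Qed.

Lemma max0_continuous (R : realType) : continuous (Num.max (0 : R)).
Proof.
move=> t; apply/cvgrPdist_lt => e e0; near=> s.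
apply: le_lt_trans (distr_max0 _ _) _.
by near: s; exact: near_distr.
Unshelve. all: end_near. Qed.

Lemma continuous_bounded_itv (R : realType) (V : normedModType R) (f : R -> V)
    (a b : R) : continuous f ->
  exists2 K, 0 <= K & forall s, a <= s <= b -> `|f s| <= K.
Proof.
move=> cf.
have := continuous_compact (continuous_subspaceT cf) (@segment_compact R a b).
move=> /compact_bounded[K [_ hK]]; exists (`|K| + 1); first by rewrite addr_ge0.
move=> s sab; apply: (hK (`|K| + 1)).
  by rewrite (le_lt_trans (ler_norm _))// ltrDl.
by exists s => //=; rewrite in_itv.
Qed.

Lemma geometric_uniform_limit (R : realType) (V : completeNormedModType R)
    (I : Type) (w : nat -> I -> V) (K : R) :
  (forall n t, `|w n.+1 t - w n t| <= K * 2^-1 ^+ n) ->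
  exists l : I -> V, forall n t, `|l t - w n t| <= 2 * K * 2^-1 ^+ n.
Proof.
move=> dw.
have tail n m t : `|w (n + m)%N t - w n t| <= 2 * K * 2^-1 ^+ n * (1 - 2^-1 ^+
  m).
  elim: m => [|m ih]; first by rewrite addn0 subrr normr0 expr0 subrr mulr0.
  rewrite addnS -(subrKA (w (n + m)%N t)) (le_trans (ler_normD _ _))//.
  apply: le_trans (lerD (dw _ _) ih) _; rewrite exprS exprD.
  by move: (2^-1 ^+ m) (2^-1 ^+ n) => p q; rewrite le_eqVlt; apply/orP; left;
    apply/eqP; field.
have half0 n : 0 <= (2^-1 : R) ^+ n by rewrite exprn_ge0.
(* The sign of [K] can only be read off at a point of [I]. *)
have K0 (t : I) : 0 <= K.
  by have := le_trans (normr_ge0 _) (dw 0%N t); rewrite expr0 mulr1.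
have {}tail n m t : (n <= m)%N -> `|w m t - w n t| <= 2 * K * 2^-1 ^+ n.
  move=> /subnKC <-; apply: le_trans (tail _ _ _) _.
  by rewrite ler_piMr ?mulr_ge0 ?(K0 t)// gerBl half0.
have small (e : R) : 0 < e -> exists n, `|2 * K * 2^-1 ^+ n| < e.
  move=> e0; have /cvgrPdist_lt/(_ _ e0)[n _ h] :
      geometric (2 * K) 2^-1 @ \oo --> (0 : R).
    by apply: cvg_geometric; rewrite ger0_norm ?invr_ge0// invf_lt1// ltr1n.
  by exists n; have := h n (leqnn n); rewrite sub0r normrN.
have cw t : cvgn (fun n => w n t).
  apply/cauchy_cvgP/cauchy_exP => e /small[n ne].
  exists (w n t), n => // m /= nm; rewrite -ball_normE/= distrC.
  exact: le_lt_trans (tail _ _ _ nm) (le_lt_trans (ler_norm _) ne).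
exists (fun t => limn (fun n => w n t)) => n t; apply/ler_addgt0Pl => e e0.
have /cvgrPdist_lt/(_ _ e0) [m _ hm] := cw t.
rewrite -(subrKA (w (maxn n m) t)) (le_trans (ler_normD _ _))// lerD//.
  by apply/ltW/hm; rewrite /= leq_maxr.
by apply: tail; rewrite leq_maxl.
Qed.

Section duhamel.
Context {R : realType} {H : completeNormedModType R} (S : R -> H -> H).
Hypothesis HS : C0_semigroup S.
Implicit Types (f g : R -> H) (t s : R).

(* The truncation [Num.max 0] makes the integrand continuous on the whole line. *)
Definition duhamel_integrand f t s : H := S (Num.max 0 (t - s)) (f s).

Definition duhamel f t : H := rintegral (duhamel_integrand f t) 0 t.

Lemma duhamel_integrand_cvg f (T : Type) (F : set_system T) {FF : Filter F}
    (a b : T -> R) t s : continuous f ->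
  a x @[x --> F] --> t -> b x @[x --> F] --> s ->
  duhamel_integrand f (a x) (b x) @[x --> F] --> duhamel_integrand f t s.
Proof.
move=> cf aF bF; apply: (semigroup_cvg HS); first exact: cvgB.
exact: (@cvg_comp _ _ _ b f F _ _ bF (cf s)).
Qed.

Lemma duhamel_integrand_continuous f t : continuous f ->
  continuous (duhamel_integrand f t).
Proof.
by move=> cf s; apply: duhamel_integrand_cvg => //; exact: cvg_cst.
Qed.

Lemma duhamel_integrand_norm f t M K s : 0 <= s <= t -> 0 <= M ->
  (forall s, 0 <= s <= t -> forall v, `|S s v| <= M * `|v|) ->
  `|f s| <= K -> `|duhamel_integrand f t s| <= M * K.
Proof.
move=> /andP[s0 st] M0 SM fK; rewrite /duhamel_integrand max_r ?subr_ge0//.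
apply: le_trans (SM _ _ _) _; last by rewrite ler_wpM2l.
by rewrite subr_ge0 st gerBl.
Qed.

Lemma duhamel_norm f t M K : 0 <= t -> continuous f -> 0 <= M ->
  (forall s, 0 <= s <= t -> forall v, `|S s v| <= M * `|v|) ->
  (forall s, 0 <= s <= t -> `|f s| <= K) -> `|duhamel f t| <= t * (M * K).
Proof.
move=> t0 cf M0 SM fK; rewrite -{2}(subr0 t); apply: rintegral_norm => //.
  exact: duhamel_integrand_continuous.
by move=> s st; apply: duhamel_integrand_norm (fK _ st).
Qed.

Lemma duhamel_normB f g t M K : 0 <= t -> continuous f -> continuous g ->
  0 <= M ->
  (forall s, 0 <= s <= t -> forall v, `|S s v| <= M * `|v|) ->
  (forall s, 0 <= s <= t -> `|f s - g s| <= K) ->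
  `|duhamel f t - duhamel g t| <= t * (M * K).
Proof.
move=> t0 cf cg M0 SM fgK; rewrite -{3}(subr0 t).
apply: rintegral_normB => //; try exact: duhamel_integrand_continuous.
move=> s /[dup] st /andP[s0 st'].
rewrite /duhamel_integrand -(semigroupB HS) ?le_max ?lexx//.
by apply: (@duhamel_integrand_norm (f \- g) t); rewrite ?s0//; exact: fgK.
Qed.

Lemma duhamel_ext f g t : 0 <= t -> continuous f ->
  (forall s, 0 <= s <= t -> f s = g s) -> duhamel f t = duhamel g t.
Proof.
move=> t0 cf fg; apply/esym/rintegral_eq => //.
apply: (Riemann_integral_ext _
  (rintegralP t0 (@duhamel_integrand_continuous f t cf))).
by move=> s st; rewrite /duhamel_integrand fg.
Qed.

(** On [[0, t0]] the semigroup law lets [S t] factor out of the integrand, and a bounded linear map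
    commutes with the Riemann integral; the rest of the integral is translated by [t0]. *)
Lemma duhamel_restart f t0 t : 0 <= t0 -> 0 <= t -> continuous f ->
  duhamel f (t0 + t) = S t (duhamel f t0) + duhamel (fun s => f (s + t0)) t.
Proof.
move=> h0 h cf; have h0t : t0 <= t0 + t by rewrite lerDl.
have cI := @duhamel_integrand_continuous f (t0 + t) cf.
rewrite /duhamel (rintegral_chasles h0 h0t cI); congr (_ + _).
  apply: rintegral_eq => //.
  have [M M1 hM] := semigroup_bound HS t.
  have := Riemann_integral_linear (semigroup_linearP HS h) (hM t _)
    (rintegralP h0 (@duhamel_integrand_continuous f t0 cf)).
  rewrite h lexx => /(_ isT); apply: Riemann_integral_ext => s /andP[s0 st].
  rewrite /duhamel_integrand /= !max_r ?subr_ge0 ?(le_trans st)//.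
  by rewrite -(semigroupD HS) ?subr_ge0//; congr (S _ _); ring.
apply/esym/rintegral_eq => //.
have := @Riemann_integral_shift _ _ (duhamel_integrand f (t0 + t)) 0 t t0.
rewrite add0r (addrC t) => /(_ _ (rintegralP h0t cI)).
apply: Riemann_integral_ext => s st.
by rewrite /duhamel_integrand; congr (S (Num.max _ _) _); ring.
Qed.

(** For two nearby times [a] and [b] the integrals are compared on [[0, min a b]], where by
    compactness the integrands are uniformly close; the remaining pieces have total length [|a - b|]
    and a bounded integrand. *)
Lemma duhamel_continuous f : continuous f ->
  continuous (fun t => duhamel f (Num.max 0 t)).
Proof.
move=> cf t; set T := Num.max 0 t + 1.
have T0 : 0 < T by rewrite ltr_wpDl// le_max lexx.
have [M M1 hM] := semigroup_bound HS T.
have M0 : 0 <= M by exact: le_trans ler01 M1.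
have [K K0 hK] := continuous_bounded_itv 0 T cf.
apply/cvgrPdist_le => e e0.
have e2 : 0 < e / 2 by rewrite divr_gt0.
have e3 : 0 < e / 2 / T by rewrite divr_gt0.
have MK : 0 < M * K + 1 by rewrite ltr_wpDl// mulr_ge0.
have close : \forall t' \near t, `[0, T] `<=` [set s |
    `|duhamel_integrand f (Num.max 0 t) s -
      duhamel_integrand f (Num.max 0 t') s| < e / 2 / T].
  have /compact_near_coveringP cov := @segment_compact R 0 T.
  apply: (cov R (nbhs t) (fun t' =>
    [set s | `|duhamel_integrand f (Num.max 0 t) s -
      duhamel_integrand f (Num.max 0 t') s| < e / 2 / T])) => s _.
  have c1 : (fun x : R * R => x.2) x @[x --> filter_prod (nbhs s) (nbhs t)] -->
    t by exact: cvg_snd.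
  have c2 : (fun x : R * R => x.1) x @[x --> filter_prod (nbhs s) (nbhs t)] -->
    s by exact: cvg_fst.
  have c3 : Num.max 0 x.2 @[x --> filter_prod (nbhs s) (nbhs t)] -->
    Num.max 0 t.
    exact: (@cvg_comp _ _ _ _ (Num.max 0) _ _ _ c1 (@max0_continuous R t)).
  have d1 : duhamel_integrand f (Num.max 0 x.2) x.1 @[x -->
    filter_prod (nbhs s) (nbhs t)]
      --> duhamel_integrand f (Num.max 0 t) s by exact: duhamel_integrand_cvg.
  have d2 : duhamel_integrand f (Num.max 0 t) x.1 @[x -->
    filter_prod (nbhs s) (nbhs t)]
      --> duhamel_integrand f (Num.max 0 t) s.
    by apply: duhamel_integrand_cvg => //; exact: cvg_cst.
  have e6 : 0 < e / 2 / T / 2 by rewrite divr_gt0.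
  move/cvgrPdist_lt : d1 => /(_ _ e6); move/cvgrPdist_lt : d2 => /(_ _ e6).
  apply: filterS2 => x /= h2 h1.
  rewrite -(subrKA (duhamel_integrand f (Num.max 0 t) s)) [ltRHS]splitr.
  by rewrite (le_lt_trans (ler_normD _ _))// ltrD// distrC.
near=> t'.
set a := Num.max 0 t; set b := Num.max 0 t'.
have a0 : 0 <= a by rewrite le_max lexx.
have b0 : 0 <= b by rewrite le_max lexx.
have ab : `|a - b| < e / 2 / (M * K + 1).
  apply: le_lt_trans (distr_max0 _ _) _.
  by near: t'; exact: (near_distr t (divr_gt0 e2 MK)).
have ab1 : `|a - b| < 1.
  apply: le_lt_trans (distr_max0 _ _) _.
  by near: t'; exact: near_distr.
have aT : a <= T by rewrite lerDl.
have bT : b <= T by move: ab1; rewrite ltr_norml /T -/a; lra.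
pose m := Num.min a b.
have m0 : 0 <= m by rewrite le_min a0.
have ma : m <= a by rewrite ge_min lexx.
have mb : m <= b by rewrite ge_min lexx orbT.
have cI c := @duhamel_integrand_continuous f c cf.
rewrite /duhamel (rintegral_chasles m0 ma (cI _)) (rintegral_chasles m0 mb (cI
  _)).
have tail c : 0 <= c -> m <= c -> c <= T ->
    `|rintegral (duhamel_integrand f c) m c| <= (c - m) * (M * K).
  move=> c0 mc cT; apply: rintegral_norm => // s /andP[ms sc].
  apply: duhamel_integrand_norm => //; first by rewrite (le_trans m0).
    by move=> s' /andP[? ?]; apply: hM; apply/andP; split; lra.
  by apply: hK; apply/andP; split; lra.
have head' : `|rintegral (duhamel_integrand f a) 0 m -
    rintegral (duhamel_integrand f b) 0 m| <= (m - 0) * (e / 2 / T).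
  apply: rintegral_normB => // s /andP[s0 sm]; apply/ltW.
  apply: (near close t') => //=; rewrite in_itv/=; apply/andP; split; lra.
have head : (m - 0) * (e / 2 / T) <= e / 2.
  by rewrite subr0 mulrA ler_pdivrMr// mulrC ler_pM2l// (le_trans ma).
have := tail a a0 ma aT; have := tail b b0 mb bT.
set Ia := rintegral _ m a; set Ib := rintegral _ m b => hIb hIa.
have MK0 : 0 <= M * K by rewrite mulr_ge0.
have amb : (a - m) * (M * K) + (b - m) * (M * K) <= e / 2.
  have -> : (a - m) * (M * K) + (b - m) * (M * K) = `|a - b| * (M * K).
    rewrite -mulrDl /m minEle; case: ifPn => [h|].
      by rewrite distrC ger0_norm ?subr_ge0// subrr add0r.
    by rewrite -ltNge => /ltW h; rewrite ger0_norm ?subr_ge0// subrr addr0.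
  apply: (@le_trans _ _ (`|a - b| * (M * K + 1))).
    by rewrite ler_wpM2l// lerDl.
  by rewrite -ler_pdivlMr// ltW.
rewrite opprD addrACA (le_trans (ler_normD _ _))// [leRHS]splitr lerD//.
  exact: le_trans head' head.
rewrite (le_trans (ler_normB _ _))// (le_trans _ amb)//; exact: lerD.
Unshelve. all: end_near. Qed.

End duhamel.

(** * The delay equation *)

Lemma minr0E (R : realDomainType) (s : R) : Num.min s 0 = s - Num.max 0 s.
Proof. by rewrite minEle maxEle; case: ltgtP => [_|_|->]; ring. Qed.

Lemma minr0_continuous (R : realType) : continuous (fun s : R => Num.min s 0).
Proof.
rewrite (_ : (fun s => _) = fun s => s - Num.max 0 s); last first.
  by apply/funext => s; rewrite minr0E.
by move=> s; apply: cvgB; [exact: cvg_id|exact: max0_continuous].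
Qed.

Lemma maxr_continuous (R : realType) (a : R) : continuous (Num.max a).
Proof.
rewrite (_ : Num.max a = fun s => Num.max 0 (s - a) + a); last first.
  by apply/funext => s; rewrite addr_maxl subrK add0r.
move=> s; apply: cvgD; last exact: cvg_cst.
have h : x - a @[x --> s] --> s - a by apply: cvgB;
  [exact: cvg_id|exact: cvg_cst].
exact: (@cvg_comp _ _ _ _ (Num.max 0) _ _ _ h (@max0_continuous R _)).
Qed.

Lemma minr_continuous (R : realType) (a : R) : continuous (fun s =>
  Num.min s a).
Proof.
rewrite (_ : (fun s => _) = fun s => Num.min (s - a) 0 + a); last first.
  by apply/funext => s; rewrite addr_minl subrK add0r.
move=> s; apply: cvgD; last exact: cvg_cst.
have h : x - a @[x --> s] --> s - a by apply: cvgB;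
  [exact: cvg_id|exact: cvg_cst].
exact: (@cvg_comp _ _ _ _ (fun x =>
  Num.min x 0) _ _ _ h (@minr0_continuous R _)).
Qed.

(** This is the clamping device: with [c] mapping the line into an interval [A], a path continuous
    on [A] becomes one continuous on the whole line. *)
Lemma within_continuous_retract (R : realType) (V : normedModType R)
    (A : set R) (f : R -> V) (c : R -> R) :
  {within A, continuous f} -> continuous c -> (forall s, A (c s)) ->
  continuous (f \o c).
Proof.
move=> /subspace_continuousP cf cc cA s; apply/cvgrPdist_lt => e e0.
have /cvgrPdist_lt/(_ _ e0)/nbhs_ballP[rho /= rho0 h] := cf _ (cA s).
have /cvgrPdist_lt/(_ _ rho0) := cc s.
by apply: filterS => t st; exact: h.
Qed.

Section history_norm.
Context {R : realType} {H : normedModType R} (r : R).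
Hypothesis r0 : 0 < r.
Implicit Types (f g : history r H) (u v : R -> H) (t s : R).

Lemma history_norm_ge f s : - r <= s <= 0 -> `|f s| <= `|f|.
Proof.
move=> rs; rewrite history_normE; apply: ub_le_sup; last first.
  by exists s => //=; rewrite in_itv.
have := continuous_compact (@history_continuous _ _ _ f) (@segment_compact _ _
  _).
move=> /compact_bounded [M [_ hM]]; exists (M + 1) => _ [t rt <-].
by apply: (hM (M + 1)); [rewrite ltrDl|exists t].
Qed.

Lemma history_norm_le f M :
  (forall s, - r <= s <= 0 -> `|f s| <= M) -> `|f| <= M.
Proof.
move=> fM; rewrite history_normE; apply: ge_sup.
  by exists `|f 0|; exists 0 => //=; rewrite in_itv/= lexx oppr_le0 ltW.
by move=> _ [s + <-]; rewrite /= in_itv => /fM.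
Qed.

Lemma history_subE f g s : (f - g) s = f s - g s.
Proof. by []. Qed.

Lemma segment_apply u t s : continuous u -> - r <= s <= 0 ->
  segment r u t s = u (t + s).
Proof. by move=> cu rs; rewrite segmentE//; exact: continuous_subspaceT. Qed.

Lemma segment_dist_le u v t t' M : continuous u -> continuous v ->
  (forall s, - r <= s <= 0 -> `|u (t + s) - v (t' + s)| <= M) ->
  `|segment r u t - segment r v t'| <= M.
Proof.
move=> cu cv uv; apply: history_norm_le => s rs.
by rewrite history_subE !segment_apply//; exact: uv.
Qed.

Lemma segment_dist_ge u v t t' s : continuous u -> continuous v ->
  - r <= s <= 0 ->
  `|u (t + s) - v (t' + s)| <= `|segment r u t - segment r v t'|.
Proof.
move=> cu cv rs; apply: le_trans (history_norm_ge _ rs).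
by rewrite history_subE !segment_apply.
Qed.

Lemma segment_continuous u : continuous u -> continuous (segment r u).
Proof.
move=> cu t; apply/cvgrPdist_le => e e0.
have [rho rho0 h] := compact_unif_continuous
  (@segment_compact R (t - r) t) cu e0.
near=> t'; rewrite distrC; apply: segment_dist_le => // s /andP[rs s0].
apply/ltW/h => /=.
  by rewrite in_itv/=; apply/andP; split; lra.
by rewrite opprD addrACA subrr addr0 distrC; near: t'; exact: near_distr.
Unshelve. all: end_near. Qed.

Lemma segment_shift u t0 t : segment r (fun s =>
  u (s + t0)) t = segment r u (t + t0).
Proof.
congr (insubd 0 _); apply/funext => s; case: ifP => // _.
by congr u; ring.
Qed.

End history_norm.

Section delay.
Context {R : realType} {H : completeNormedModType R} (S : R -> H -> H).
Hypothesis HS : C0_semigroup S.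
Variables (r d LB : R) (B : H -> H).
Variables (Theta_u Theta_l eta : history r H -> R).
Hypothesis r0 : 0 < r.
Hypothesis d0 : 0 <= d.
Hypothesis Theta_l_continuous : continuous Theta_l.
Hypothesis Theta_r : forall phi, Theta_u phi <= r.
Hypothesis Theta_gt0 : forall phi, 0 < Theta_l phi.
Hypothesis eta_continuous : continuous eta.
Hypothesis eta_itv : forall phi, 0 <= eta phi <= r.
Hypothesis eta_ignore : forall phi psi : history r H,
  (forall theta, - Theta_u phi <= theta <= - Theta_l phi ->
     psi theta = phi theta) -> eta psi = eta phi.
Hypothesis LB0 : 0 <= LB.
Hypothesis B_lip : forall v1 v2, `|B v1 - B v2| <= LB * `|v1 - v2|.
Implicit Types (u v w : R -> H) (t s T : R) (phi psi : history r H).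
Local Notation segment := (segment r).

(** * The mild equation and its translation in time *)

Definition forcing u t : H := delay_term B eta (segment u t) - d *: u t.

Lemma B_continuous : continuous B.
Proof.
move=> v; apply/cvgrPdist_lt => e e0; near=> w.
apply: le_lt_trans (B_lip _ _) _.
apply: (@le_lt_trans _ _ ((LB + 1) * `|v - w|)).
  by rewrite ler_wpM2r// lerDl.
rewrite -ltr_pdivlMl ?ltr_wpDl// mulrC.
near: w; apply/nbhs_ballP; exists (e / (LB + 1)) => /=.
  by rewrite divr_gt0// ltr_wpDl.
by move=> w; rewrite -ball_normE.
Unshelve. all: end_near. Qed.

Lemma delay_termE u t : continuous u ->
  delay_term B eta (segment u t) = B (u (t - eta (segment u t))).
Proof.
move=> cu; rewrite /delay_term segment_apply//.
by have := eta_itv (segment u t); rewrite lerN2 oppr_le0 andbC.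
Qed.

(** The delay is here any continuous function of time, which covers both the actual delay of a path
    and a delay frozen along another path. *)
Lemma delayed_continuous u (tau : R -> R) : continuous u -> continuous tau ->
  continuous (fun t => B (u (t - tau t)) - d *: u t).
Proof.
move=> cu ct t; apply: cvgB; last by apply: cvgZr; exact: cu.
have h : s - tau s @[s --> t] --> t - tau t by apply: cvgB;
  [exact: cvg_id|exact: ct].
have h' : u (s - tau s) @[s --> t] --> u (t - tau t)
  by exact: cvg_comp h (cu _).
exact: (@cvg_comp _ _ _ (fun s => u (s - tau s)) B _ _ _ h' (@B_continuous _)).
Qed.

Lemma delay_continuous u : continuous u -> continuous (eta \o segment u).
Proof.
move=> cu t.
exact: (@cvg_comp _ _ _ (segment u) eta _ _ _ (@segment_continuous _ _ _ r0 _ cu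
  t) (@eta_continuous _)).
Qed.

Lemma forcing_continuous u : continuous u -> continuous (forcing u).
Proof.
move=> cu; have -> : forcing u = fun t =>
  B (u (t - (eta \o segment u) t)) - d *: u t.
  by apply/funext => t; rewrite /forcing delay_termE.
exact/delayed_continuous/delay_continuous.
Qed.

(* The mild formulation for a path [u] that is continuous on the whole line;
   its initial function is [segment u 0]. *)
Definition mild u T := forall t, 0 <= t <= T ->
  u t = S t (u 0) + duhamel S (forcing u) t.

Lemma mild_le u T T' : T <= T' -> mild u T' -> mild u T.
Proof. by move=> TT m t /andP[t0 tT]; apply: m; rewrite t0 (le_trans tT). Qed.

Lemma shift_continuous u t0 : continuous u -> continuous (fun s => u (s + t0)).
Proof.
move=> cu t; have h : s + t0 @[s --> t] --> t + t0.
  by apply: cvgD; [exact: cvg_id|exact: cvg_cst].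
exact: cvg_comp h (cu _).
Qed.

Lemma forcing_shift u t0 t : forcing (fun s =>
  u (s + t0)) t = forcing u (t + t0).
Proof. by rewrite /forcing segment_shift. Qed.

(** The mild formula is assumed only up to [t0], so that the identity serves both to restart a
    solution and to glue two of them. *)
Lemma mild_restart_eq u t0 t : continuous u -> 0 <= t0 -> 0 <= t -> mild u t0 ->
  S (t0 + t) (u 0) + duhamel S (forcing u) (t0 + t) =
  S t (u t0) + duhamel S (forcing (fun s => u (s + t0))) t.
Proof.
move=> cu t00 t_0 m; rewrite (duhamel_restart HS)//;
  last exact: forcing_continuous.
rewrite (m t0) ?t00 ?lexx// addrA addrC [in RHS]addrC; congr (_ + _).
  by congr (duhamel _ _ _); apply/funext => s; rewrite forcing_shift.
rewrite (addrC t0) (semigroupD HS)//.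
have linS := semigroup_linearP HS t_0.
by have := linS 1 (S t0 (u 0)) (duhamel S (forcing u) t0); rewrite !scale1r =>
  ->.
Qed.

Lemma mild_shift u t0 T : continuous u -> 0 <= t0 -> 0 <= T ->
  mild u (t0 + T) -> mild (fun s => u (s + t0)) T.
Proof.
move=> cu t00 T0 m t /andP[t_0 tT]; rewrite add0r -mild_restart_eq//.
  by rewrite addrC; apply: m; rewrite addr_ge0//= lerD2l.
by apply: mild_le m; rewrite lerDl.
Qed.

Lemma mild_cat u t0 T : continuous u -> 0 <= t0 ->
  mild u t0 -> mild (fun s => u (s + t0)) T -> mild u (t0 + T).
Proof.
move=> cu t00 m m' t /andP[t_0 tT]; have [tt0|t0t] := leP t t0.
  by apply: m; rewrite t_0.
have tt0 : 0 <= t - t0 by rewrite subr_ge0 ltW.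
have := m' (t - t0); rewrite tt0 lerBlDl => /(_ tT).
rewrite subrK add0r => ->; rewrite -mild_restart_eq//.
by rewrite (addrC t0) subrK.
Qed.

(** * Stability along a given solution *)

Lemma compact_trajectory u a b : continuous u ->
  compact (segment u @` `[a, b]).
Proof.
move=> cu; apply: continuous_compact; last exact: segment_compact.
exact/continuous_subspaceT/segment_continuous.
Qed.

Lemma rhs_dist (x y p q : H) (K1 K2 : R) :
  `|x - y| <= K1 -> `|p - q| <= K2 ->
  `|(B x - d *: p) - (B y - d *: q)| <= LB * K1 + d * K2.
Proof.
move=> xy pq.
have -> : (B x - d *: p) - (B y - d *: q) = (B x - B y) - d *: (p - q).
  by rewrite scalerBr opprD addrACA -opprD.
rewrite (le_trans (ler_normB _ _))// lerD//.
  by rewrite (le_trans (B_lip _ _))// ler_wpM2l.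
by rewrite normrZ ger0_norm// ler_wpM2l.
Qed.

(** Gronwall by absorption: with [m] the maximum of [|v - u|] on [[0, delta]], the mild formulas
    bound [m] by an expression containing [m] itself with a factor at most
    [delta * M * (LB + d) <= 2^-1]. The bound [delta + delta <= Theta_l] keeps the window read by
    [eta] before time 0 during the whole step, even after [Theta_l] has changed by [delta]. *)
Lemma stability_step u delta M e : continuous u -> 0 < delta -> mild u delta ->
  1 <= M -> (forall t, 0 <= t <= delta -> forall x, `|S t x| <= M * `|x|) ->
  delta * M * (LB + d) <= 2^-1 ->
  (forall t, 0 <= t <= delta -> delta + delta <= Theta_l (segment u t)) ->
  0 < e ->
  exists2 rho, 0 < rho & forall v, continuous v -> mild v delta ->
    `|segment v 0 - segment u 0| < rho ->
    forall t, 0 <= t <= delta -> `|segment v t - segment u t| <= e.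
Proof.
move=> cu de0 mu M1 SM small Thu e0; have M0 : 0 < M by exact: lt_le_trans M1.
have e2 : 0 < e / 2 by rewrite divr_gt0.
have [om om0 hom] := compact_unif_continuous
  (@segment_compact R (- r) delta) cu e2.
have [rho1 rho10 h1] := compact_unif_continuous
  (compact_trajectory (a := 0) (b := delta) cu) eta_continuous om0.
have [rho2 rho20 h2] := compact_unif_continuous
  (compact_trajectory (a := 0) (b := delta) cu) Theta_l_continuous de0.
(* Within [rho1] and [rho2] of the trajectory, [eta] and [Theta_l] change by less than [om] and
   [delta]. The third bound is dictated by the final estimate [D + m <= (2 * M + 2) * D + e / 2],
   whose right-hand side has to be at most [e]. *)
pose rho := Num.min (Num.min rho1 rho2) (e / 2 / (2 * M + 2)).
have M2 : 0 < 2 * M + 2 by lra.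
exists rho => [|v cv mv vu]; first by rewrite !lt_min rho10 rho20 divr_gt0.
set D := `|segment v 0 - segment u 0| in vu.
have [Drho1 Drho2 DM] : [/\ D < rho1, D < rho2 & D * (2 * M + 2) < e / 2].
  by move: vu; rewrite !lt_min ltr_pdivlMr// => /andP[/andP[]].
have D0 : 0 <= D by exact: normr_ge0.
have vu0 s : - r <= s <= 0 -> `|v s - u s| <= D.
  by move=> rs; have := segment_dist_ge 0 0 cv cu rs; rewrite !add0r.
have lag t : 0 <= t <= delta ->
    `|eta (segment v t) - eta (segment u t)| < om.
  move=> td; have /andP[t_0 t_d] := td.
  (* [w] has the same history as [v] and differs from [u] by at most [D], so
     [Theta_l w_t > delta] and hence [eta v_t = eta w_t]. *)
  pose w s := v (Num.min s 0) + (u (Num.max 0 s) - u 0).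
  have cw : continuous w.
    move=> s; apply: cvgD.
      exact: (@cvg_comp _ _ _ (fun s => Num.min s 0) v _ _ _
        (@minr0_continuous R s) (@cv _)).
    apply: cvgB; last exact: cvg_cst.
    exact: (@cvg_comp _ _ _ _ u _ _ _ (@max0_continuous R s) (@cu _)).
  have wu : `|segment w t - segment u t| <= D.
    apply: segment_dist_le => // s /andP[rs s0]; rewrite /w /=.
    have [h|h] := ltP 0 (t + s).
      rewrite addrC addrCA addKr.
      by apply: vu0; rewrite lexx oppr_le0 ltW.
    rewrite subrr addr0; apply: vu0.
    by apply/andP; split; lra.
  have Ku : (segment u @` `[0, delta]) (segment u t) by exists t => //=;
    rewrite in_itv.
  rewrite (_ : eta (segment v t) = eta (segment w t)).
    by apply: h1 => //; exact: le_lt_trans Drho1.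
  apply: eta_ignore => th /andP[th1 th2].
  have := h2 _ (segment w t) Ku (le_lt_trans wu Drho2).
  rewrite ltr_norml => /andP[hT _]; have := Thu _ td => hu.
  have := Theta_r (segment w t); have := Theta_gt0 (segment w t) => ? ?.
  have thr : - r <= th <= 0 by apply/andP; split; lra.
  rewrite !segment_apply// /w /= (max_l (_ : t + th <= 0)); last lra.
  by rewrite min_l ?subrr ?addr0//; lra.
have [tm /itvP tmI hm] : exists2 tm, tm \in `[0, delta] &
    forall t, t \in `[0, delta] -> `|v t - u t| <= `|v tm - u tm|.
  apply: (@EVT_max R (fun t => `|v t - u t|)); first exact: ltW.
  apply: continuous_subspaceT => t.
  by apply: cvg_norm; apply: cvgB; [exact: cv|exact: cu].
set m := `|v tm - u tm| in hm.
have m0 : 0 <= m by exact: normr_ge0.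
have vum s : - r <= s <= delta -> `|v s - u s| <= D + m.
  move=> /andP[rs sd]; have [s0|s0] := leP s 0.
    by rewrite ler_wpDr// vu0// rs.
  by rewrite ler_wpDl// hm// in_itv/= ltW.
have forc s : 0 <= s <= tm ->
    `|forcing v s - forcing u s| <= (LB + d) * (D + m) + LB * (e / 2).
  move=> /andP[s0 stm]; have sd : s <= delta by rewrite (le_trans stm)// tmI.
  set a := eta (segment v s); set b := eta (segment u s).
  rewrite /forcing !delay_termE//.
  have s_d : 0 <= s <= delta by rewrite s0.
  have /andP[a0 ar] : 0 <= a <= r by exact: eta_itv.
  have /andP[b0 br] : 0 <= b <= r by exact: eta_itv.
  (* In this order the change of delay acts on [u] alone, whose modulus [om] was fixed before [v];
     no modulus of continuity of [v] enters. *)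
  have vub : `|v (s - a) - u (s - b)| <= (D + m) + e / 2.
    rewrite -(subrKA (u (s - a))) (le_trans (ler_normD _ _))// lerD//.
      by apply: vum; apply/andP; split; lra.
    apply/ltW/hom; first by rewrite /= in_itv/=; apply/andP; split; lra.
    have -> : s - a - (s - b) = b - a by ring.
    by rewrite distrC; exact: lag.
  apply: le_trans (rhs_dist vub (vum s _)) _; last by rewrite mulrDl mulrDr;
    lra.
  by apply/andP; split; lra.
have tm0 : 0 <= tm by rewrite tmI.
have tmd : tm <= delta by rewrite tmI.
have tm_ : 0 <= tm <= delta by rewrite tm0.
have mle : m <= M * D + tm * (M * ((LB + d) * (D + m) + LB * (e / 2))).
  rewrite {1}/m (mv _ tm_) (mu _ tm_) opprD addrACA -(semigroupB HS)//.
  apply: le_trans (ler_normD _ _) _; apply: lerD.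
    apply: le_trans (SM _ tm_ _) _; apply: ler_wpM2l; first exact: ltW.
    by apply: vu0; rewrite lexx oppr_le0 ltW.
  apply: duhamel_normB => //; try exact: forcing_continuous.
  - exact: ltW.
  - by move=> s /andP[s0 stm] x; apply: SM; rewrite s0 (le_trans stm).
have m_le : m <= (2 * M + 1) * D + e / 2.
  suff : tm * (M * ((LB + d) * (D + m) + LB * (e / 2))) <= 2^-1 * (D + m + e /
    2).
    move=> h.
have := le_trans mle (lerD (lexx _) h).
    by lra.
  apply: (@le_trans _ _ (delta * M * (LB + d) * (D + m + e / 2))); last first.
    by rewrite ler_wpM2r// !addr_ge0// ltW.
  rewrite -!mulrA ler_pM//.
  - rewrite mulr_ge0 ?(ltW M0)// addr_ge0 ?mulr_ge0 ?addr_ge0//; exact: ltW.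
  - rewrite ler_wpM2l ?(ltW M0)// [leRHS]mulrDr lerD2l ler_wpM2r ?(ltW e2)//.
    by rewrite lerDl.
move=> t /andP[t_0 td]; apply: segment_dist_le => // s /andP[rs s0].
apply: le_trans (vum _ _) _; first by apply/andP; split; lra.
by lra.
Qed.

Lemma stability u T e : continuous u -> 0 <= T -> mild u T -> 0 < e ->
  exists2 rho, 0 < rho & forall v, continuous v -> mild v T ->
    `|segment v 0 - segment u 0| < rho ->
    forall t, 0 <= t <= T -> `|segment v t - segment u t| <= e.
Proof.
move=> cu T0 mu.
have [M M1 SM] := semigroup_bound HS T.
have M0 : 0 <= M by exact: le_trans ler01 M1.
have [tm _ hm] : exists2 tm, tm \in `[0, T] &
    forall t, t \in `[0, T] -> Theta_l (segment u tm) <= Theta_l (segment u t).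
  apply: (@EVT_min R (Theta_l \o segment u)) => //.
  apply: continuous_subspaceT => t.
  exact: (@cvg_comp _ _ _ (segment u) Theta_l _ _ _
    (@segment_continuous _ _ _ r0 _ cu t) (@Theta_l_continuous _)).
set c := Theta_l (segment u tm) in hm.
have c0 : 0 < c by exact: Theta_gt0.
(* A number of steps above [X] makes [delta] small enough: the first summand yields [deltac], the
   second [small]. *)
pose X := T * (2 / c) + T * (2 * (M * (LB + d))).
have X1 : 0 <= T * (2 / c) by rewrite mulr_ge0// divr_ge0// ltW.
have X2 : 0 <= T * (2 * (M * (LB + d))) by rewrite !mulr_ge0// addr_ge0.
have XN := truncnS_gt X; set N := (Num.truncn X).+1 in XN.
have N0 : 0 < N%:R :> R by rewrite ltr0n.
pose delta := T / N%:R.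
have delta0 : 0 <= delta by rewrite divr_ge0.
have deltac : delta + delta <= c.
  have h : T * 2 <= N%:R * c.
    rewrite -ler_pdivrMr// -mulrA; apply/ltW/(le_lt_trans _ XN).
    by rewrite lerDl.
  by rewrite -mulr2n -mulr_natr /delta mulrAC ler_pdivrMr// (mulrC c).
have small : delta * M * (LB + d) <= 2^-1.
  have -> : delta * M * (LB + d) = T * (2 * (M * (LB + d))) / N%:R * 2^-1.
    by rewrite /delta; move: (N%:R^-1) => q; field.
  rewrite ler_piMl// ler_pdivrMr// mul1r; apply/ltW/(le_lt_trans _ XN).
  by rewrite lerDr.
have deltaN : delta * N%:R = T by rewrite divfK ?gt_eqF.
have deltak k : (k <= N)%N -> delta * k%:R <= T.
  by move=> kN; rewrite -deltaN ler_wpM2l// ler_nat.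
suff stab k : (k <= N)%N -> forall e, 0 < e ->
    exists2 rho, 0 < rho & forall v, continuous v -> mild v T ->
      `|segment v 0 - segment u 0| < rho ->
      forall t, 0 <= t <= delta * k%:R -> `|segment v t - segment u t| <= e.
  by move=> e0; have := stab N (leqnn _) e e0; rewrite deltaN.
elim: k => [_ e' e0|k ih kN e' e0].
  exists e' => // v cv mv vu t; rewrite mulr0 => /le_anti <-; exact: ltW.
have kT := deltak _ kN; rewrite -(natr1 k) mulrDr mulr1 in kT.
have k0 : 0 <= delta * k%:R by rewrite mulr_ge0.
(* The steps have length 0 when [T = 0], a case excluded by [stability_step]. *)
move: delta0; rewrite le_eqVlt => /predU1P[delta0|delta0].
  exists e' => // v cv mv vu t; rewrite -delta0 mul0r => /le_anti <-;
    exact: ltW.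
have restrict v : continuous v -> mild v T ->
    mild (fun s => v (s + delta * k%:R)) delta.
  move=> cv mv; apply: mild_shift => //; first exact: ltW.
  exact: mild_le mv.
have [|||rho' rho'0 h] := @stability_step
  (fun s => u (s + delta * k%:R)) delta M e' _ delta0 (restrict _ cu mu) M1 _
    small _ e0.
- exact: shift_continuous.
- move=> t /andP[t0 td] x; apply: SM; rewrite t0 (le_trans td)//.
  by apply: le_trans kT; rewrite lerDr.
- move=> t /andP[t0 td]; rewrite segment_shift; apply: le_trans deltac _.
  by apply: hm; rewrite in_itv/=; apply/andP; split; lra.
(* The closeness required at the start of the last step becomes the target of the preceding ones;
   halving [rho'] turns their weak inequality into a strict one. *)
have [|rho rho0 h'] := ih (ltnW kN) (Num.min e' (rho' / 2)).
  by rewrite lt_min e0 divr_gt0.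
exists rho => // v cv mv vu t /andP[t0 tk].
have [tk'|tk'] := leP t (delta * k%:R).
  apply: le_trans (h' v cv mv vu t _) _; first by rewrite t0.
  by rewrite ge_min lexx.
have := h _ (shift_continuous (t0 := delta * k%:R) cv) (restrict _ cv mv).
rewrite !segment_shift add0r => /(_ _ (t - delta * k%:R)).
rewrite !segment_shift subrK; apply.
  apply: le_lt_trans (h' v cv mv vu _ _) _; first by rewrite k0 lexx.
  by rewrite gt_min; apply/orP; right; lra.
by move: tk; rewrite -(natr1 k) mulrDr mulr1 => ?; apply/andP; split; lra.
Qed.

Lemma mild_unique u v T : continuous u -> continuous v -> mild u T ->
  mild v T ->
  segment v 0 = segment u 0 -> forall t, - r <= t <= T -> v t = u t.
Proof.
move=> cu cv mu mv vu t /andP[rt tT]; have rt0 : - r <= 0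
  by rewrite oppr_le0 ltW.
have [t0|t0] := leP t 0.
  have rt' : - r <= t <= 0 by rewrite rt.
  by have := segment_apply 0 cv rt'; rewrite add0r => <-;
    rewrite vu segment_apply// add0r.
suff /eqP : `|segment v t - segment u t| == 0.
  move=> h; apply/eqP; rewrite -subr_eq0 -normr_le0 -h.
  have rr : - r <= (0 : R) <= 0 by rewrite rt0 lexx.
  by have := segment_dist_ge t t cv cu rr; rewrite !addr0.
rewrite eq_le normr_ge0 andbT; apply/ler_addgt0Pl => e e0; rewrite addr0.
have [|rho rho0 h] := stability cu _ mu e0; first
  by rewrite (le_trans (ltW t0)).
by apply: h => //; rewrite ?vu ?subrr ?normr0// (ltW t0).
Qed.

(** * Local existence *)

Lemma history_extension phi : exists2 u, continuous u &
  forall s, u s = phi (Num.max (- r) (Num.min s 0)).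
Proof.
exists (phi \o (fun s => Num.max (- r) (Num.min s 0))) => //.
apply: (within_continuous_retract (@history_continuous _ _ _ phi)).
  rewrite (_ : (fun s => _) = fun s => - Num.min (- Num.min s 0) r); last first.
    by apply/funext => s; rewrite oppr_min opprK maxC.
  move=> s; apply: cvgN; have h : - Num.min x 0 @[x --> s] --> - Num.min s 0.
    by apply: cvgN; exact: minr0_continuous.
  exact: (@cvg_comp _ _ _ _ (fun x =>
    Num.min x r) _ _ _ h (@minr_continuous R r _)).
move=> s; rewrite /= in_itv/= le_max lexx/= ge_max oppr_le0 ltW//=.
by rewrite ge_min lexx orbT.
Qed.

Lemma local_existence phi : exists delta, 0 < delta /\
  exists u, [/\ continuous u, segment u 0 = phi & mild u delta].
Proof.
have [v cv vE] := history_extension phi.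
have v_ge0 t : 0 <= t -> v t = phi 0.
  by move=> t0; rewrite vE min_r// max_r// oppr_le0 ltW.
have [M M1 SM] := semigroup_bound HS 1.
have M0 : 0 <= M by exact: le_trans ler01 M1.
set c := Theta_l (segment v 0).
have c0 : 0 < c by exact: Theta_gt0.
have c2 : 0 < c / 2 by rewrite divr_gt0.
have [h h0 hc] : exists2 h, 0 < h & forall s, `|s| < h ->
  c / 2 < Theta_l (segment v s).
  have := @cvg_comp _ _ _ (segment v) Theta_l _ _ _
    (@segment_continuous _ _ _ r0 _ cv 0) (@Theta_l_continuous _).
  move=> /cvgrPdist_lt/(_ _ c2)/nbhs_ballP[h /= h0 hh]; exists h => // s sh.
  have := hh s; rewrite /ball/= sub0r normrN => /(_ sh).
  by rewrite -/c ltr_norml; lra.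
have ML : 0 <= M * (LB + d) by rewrite mulr_ge0// addr_ge0.
(* The first two bounds give [s < h] and [s <= c / 2 < Theta_l (segment v s)] for [s] in the step,
   so the window read by [eta] lies before time 0. The third gives the contraction ratio 1/2 and
   [delta <= 1], the range of [SM]. *)
pose delta := Num.min (Num.min (h / 2) (c / 2)) (2 * (M * (LB + d) + 1))^-1.
have delta0 : 0 < delta by rewrite !lt_min c2 divr_gt0//= invr_gt0; lra.
have [dh dc dM] : [/\ delta <= h / 2, delta <= c / 2 &
    delta <= (2 * (M * (LB + d) + 1))^-1].
  by rewrite /delta !ge_min !lexx !orbT.
have d1 : delta <= 1.
  by apply: le_trans dM _; rewrite invf_le1; lra.
have small : delta * M * (LB + d) <= 2^-1.
  rewrite -mulrA; apply: le_trans (ler_wpM2r ML dM) _.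
  by rewrite mulrC ler_pdivrMr; lra.
have Sd t : 0 <= t <= delta -> forall x, `|S t x| <= M * `|x|.
  by move=> /andP[t0 td] x; apply: SM; rewrite t0 (le_trans td).
(* The delay is frozen to that of the constant extension [v] of [phi]. *)
pose g w t := B (w (t - (eta \o segment v) t)) - d *: w t.
have cg w : continuous w -> continuous (g w).
  by move=> cw; apply: delayed_continuous => //; exact: delay_continuous.
pose G w t := S (Num.max 0 t) (phi 0) + duhamel S (g w) (Num.max 0 t).
(* As [v] is constant equal to [phi 0] for positive times, [Phi w] coincides with [G w] on
   [[0, delta]]; it is [v] before 0 and constant after [delta]. The iteration thus runs on paths
   over the whole line, with uniform estimates. *)
pose Phi w t := v t + (G w (Num.min t delta) - phi 0).
have cG w : continuous w -> continuous (G w).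
  move=> cw t; apply: cvgD; first exact: semigroup_orbit_continuous.
  by apply: duhamel_continuous => //; exact: cg.
have cPhi w : continuous w -> continuous (Phi w).
  move=> cw t; apply: cvgD; first exact: cv.
  apply: cvgB; last exact: cvg_cst.
  exact: (@cvg_comp _ _ _ _ (G w) _ _ _ (@minr_continuous R delta t) (@cG w cw
    _)).
have duh0 w : continuous w -> duhamel S (g w) 0 = 0.
  move=> cw; apply/eqP; rewrite -normr_le0.
  apply: le_trans (@duhamel_norm _ _ S HS (g w) 0 M (`|g w 0|) _ _ _ _ _) _ =>
    //.
  - exact: cg.
  - move=> s /le_anti <- x; apply: SM; rewrite lexx ler01//.
  - by move=> s /le_anti <-.
  by rewrite mul0r.
have Phi_le0 w t : continuous w -> t <= 0 -> Phi w t = v t.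
  move=> cw t0; rewrite /Phi /G max_l ?duh0//
    ?addr0 ?(semigroup0 HS) ?subrr ?addr0//.
  by rewrite ge_min t0.
have a_itv t : 0 <= Num.max 0 (Num.min t delta) <= delta.
  by rewrite le_max lexx/= ge_max ltW// ge_min lexx orbT.
have contract w w' K : continuous w -> continuous w' ->
    (forall s, `|w s - w' s| <= K) -> forall t, `|Phi w t - Phi w' t| <= K / 2.
  move=> cw cw' ww t; rewrite /Phi /G.
  set a := Num.max 0 _; have /andP[a0 ad] : 0 <= a <= delta by exact: a_itv.
  rewrite opprD addrACA subrr add0r opprB addrA subrK opprD addrACA subrr add0r.
  have K0 : 0 <= K by exact: le_trans (normr_ge0 _) (ww 0).
  apply: (@le_trans _ _ (a * (M * (LB * K + d * K)))).
    apply: duhamel_normB => //; try exact: cg.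
      by move=> s /andP[s0 sa]; apply: Sd; rewrite s0 (le_trans sa).
    by move=> s _; exact: rhs_dist.
  rewrite -mulrDl !mulrA mulrC ler_wpM2l//; apply: le_trans small.
  by rewrite -!mulrA ler_wpM2r.
pose w n := iter n Phi v.
have cw n : continuous (w n) by elim: n => //= n; exact: cPhi.
(* The first increment depends on time only through its clamped value in [[0, delta]], hence is
   bounded on the whole line. *)
have [K K0 hK] : exists2 K, 0 <= K & forall t, `|Phi v t - v t| <= K.
  have cGv : continuous (fun t => G v t - phi 0).
    by move=> t; apply: cvgB; [exact: cG|exact: cvg_cst].
  have [K K0 hK] := continuous_bounded_itv 0 delta cGv; exists K => // t.
  rewrite /Phi addrC addKr; set b := Num.min t delta.
  suff -> : G v b = G v (Num.max 0 b) by exact/hK/a_itv.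
  by rewrite /G maxA maxxx.
have dw n t : `|w n.+1 t - w n t| <= K * 2^-1 ^+ n.
  elim: n t => [|n ih] t; first by rewrite expr0 mulr1; exact: hK.
  by rewrite exprSr mulrA; exact: (contract _ _ _ (cw n.+1) (cw n) ih).
have [u hu] := geometric_uniform_limit dw.
have small_n (e : R) : 0 < e -> exists n, 2 * K * 2^-1 ^+ n < e.
  move=> e0; have /cvgrPdist_lt/(_ _ e0)[n _ hn] :
      geometric (2 * K) 2^-1 @ \oo --> (0 : R).
    by apply: cvg_geometric; rewrite ger0_norm ?invr_ge0// invf_lt1// ltr1n.
  exists n; have := hn n (leqnn n); rewrite sub0r normrN.
  exact: le_lt_trans (ler_norm _).
have cu : continuous u.
  move=> t; apply/cvgrPdist_lt => e e0; have e3 : 0 < e / 3 by rewrite divr_gt0.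
  have [n hn] := small_n _ e3.
  have /cvgrPdist_lt/(_ _ e3) := cw n t; apply: filterS => s ts.
  have h1 : `|u t - w n t| < e / 3 by exact: le_lt_trans (hu n t) hn.
  have h2 : `|w n s - u s| < e / 3 by rewrite distrC;
    exact: le_lt_trans (hu n s) hn.
  rewrite -(subrKA (w n t)) -[X in _ + X](subrKA (w n s)).
  have := ler_normD (u t - w n t) (w n t - w n s + (w n s - u s)).
  have := ler_normD (w n t - w n s) (w n s - u s); lra.
have fix_u t : Phi u t = u t.
  apply/eqP; rewrite -subr_eq0 -normr_le0; apply/ler_addgt0Pl => e e0;
    rewrite addr0.
  have [n hn] := small_n _ e0.
  rewrite -(subrKA (w n.+1 t)) (le_trans (ler_normD _ _))//.
  have h1 := @contract u (w n) _ cu (cw n) (hu n) t.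
  have h2 := hu n.+1 t; rewrite exprS in h2; rewrite [X in _ + X]distrC.
  by apply: le_trans (lerD h1 h2) _; lra.
have u_le0 t : t <= 0 -> u t = v t by move=> t0; rewrite -fix_u Phi_le0.
have u0 : u 0 = phi 0 by rewrite u_le0// v_ge0.
exists delta; split => //; exists u; split => //.
  apply: historyE => s; rewrite /= in_itv/= => /andP[rs s0].
  rewrite segment_apply ?rs// add0r u_le0// vE.
  by rewrite (min_l s0) (max_r rs).
move=> t /andP[t0 td]; rewrite -{1}fix_u /Phi /G v_ge0// (min_l td) (max_r t0).
rewrite addrC subrK u0; congr (_ + _); apply: duhamel_ext => //;
  first exact: cg.
move=> s /andP[s0 st]; rewrite /g /forcing delay_termE//=.
have sd : s <= delta by exact: le_trans td.
rewrite (_ : eta (segment u s) = eta (segment v s))//.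
apply: eta_ignore => th /andP[th1 th2].
have := Theta_r (segment v s); have := Theta_gt0 (segment v s) => ? ?.
have : `|s| < h by rewrite ger0_norm//; lra.
move=> /hc hs.
have thr : - r <= th <= 0 by apply/andP; split; lra.
by rewrite !segment_apply// u_le0//; lra.
Qed.

(** * Continuation and global existence *)

(** The path is continuous on the whole line, but its values outside [[- r, T]] are arbitrary:
    solutions can be compared only on their common interval. *)
Definition solution phi T u :=
  [/\ continuous u, segment u 0 = phi & mild u T].

Lemma solution_unique phi T T' u v t : solution phi T u -> solution phi T' v ->
  - r <= t -> t <= T -> t <= T' -> u t = v t.
Proof.
move=> [cu u0 mu] [cv v0 mv] rt tT tT'.
apply: (@mild_unique v u t) => //; last by rewrite rt lexx.
- exact: mild_le mv.
- exact: mild_le mu.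
- by rewrite u0 v0.
Qed.

Lemma segment_eq u v T t : (forall s, - r <= s <= T -> u s = v s) ->
  0 <= t <= T -> segment u t = segment v t.
Proof.
move=> uv /andP[t0 tT]; congr (insubd 0 _); apply/funext => s.
case: ifPn => //; rewrite in_itv/= => /andP[rs s0].
by apply: uv; apply/andP; split; lra.
Qed.

Lemma solution_ext phi T u v : 0 <= T -> solution phi T v -> continuous u ->
  (forall s, - r <= s <= T -> u s = v s) -> solution phi T u.
Proof.
move=> T0 [cv v0 mv] cu uv; split=> //.
  by rewrite -v0; apply: (segment_eq uv); rewrite lexx.
move=> t /andP[t0 tT].
have rp := r0; have rt : - r <= t <= T by rewrite tT andbT; lra.
have r0T : - r <= 0 <= T by rewrite T0 oppr_le0 ltW.
rewrite (uv _ rt) (uv _ r0T).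
rewrite mv ?t0//; congr (_ + _); apply: duhamel_ext => //.
  exact: forcing_continuous.
move=> s /andP[s0 st]; have sT : s <= T by exact: le_trans tT.
rewrite /forcing uv ?(segment_eq uv) ?s0//.
by apply/andP; split; lra.
Qed.

Lemma solution_restart phi T u t0 t : solution phi T u -> 0 <= t0 <= t ->
  t <= T ->
  u t = S (t - t0) (u t0) +
    duhamel S (fun s => forcing u (s + t0)) (t - t0).
Proof.
move=> [cu u0 mu] /andP[t00 t0t] tT.
have tt0 : 0 <= t - t0 by rewrite subr_ge0.
have m := @mild_shift u t0 (t - t0) cu t00 tt0.
rewrite addrC subrK in m; have {}m := m (mild_le tT mu).
have := m (t - t0); rewrite tt0 lexx add0r subrK => -> //.
by congr (_ + duhamel _ _ _); apply/funext => s; exact: forcing_shift.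
Qed.

Lemma forcing_norm u t K : continuous u -> 
  (forall s, t - r <= s <= t -> `|u s| <= K) ->
  `|forcing u t| <= (LB + d) * K + `|B 0|.
Proof.
move=> cu uK; rewrite /forcing delay_termE//.
set e := eta _; have /andP[e0 er] : 0 <= e <= r by exact: eta_itv.
rewrite (le_trans (ler_normB _ _))// mulrDl addrAC lerD//.
  rewrite -{1}(subrK (B 0) (B _)) (le_trans (ler_normD _ _))// lerD2r.
  rewrite (le_trans (B_lip _ _))// ler_wpM2l// subr0 uK//.
  by apply/andP; split; lra.
by rewrite normrZ ger0_norm// ler_wpM2l// uK//; apply/andP; split; lra.
Qed.

(** By uniqueness the members of the family agree with the one for [T - h] up to that time, which
    gives the common bound [m]. On the last stretch, of length at most [h], the linear growth of
    [forcing] is absorbed because [h * (M * (LB + d)) <= 2^-1]. *)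
Lemma solution_bounded phi T (U : R -> R -> H) : 0 < T ->
  (forall s, 0 <= s < T -> solution phi s (U s)) ->
  exists2 K, 0 <= K &
    forall s t, 0 <= s < T -> - r <= t <= s -> `|U s t| <= K.
Proof.
move=> T0 hU; have rp := r0; have [M M1 SM] := semigroup_bound HS T.
have M0 : 0 <= M by exact: le_trans ler01 M1.
have ML : 0 <= M * (LB + d) by rewrite mulr_ge0// addr_ge0.
pose h := Num.min T (2 * (M * (LB + d) + 1))^-1.
have h0 : 0 < h by rewrite lt_min T0 invr_gt0; lra.
have hT : h <= T by rewrite ge_min lexx.
have small : h * (M * (LB + d)) <= 2^-1.
  have hM : h <= (2 * (M * (LB + d) + 1))^-1 by rewrite ge_min lexx orbT.
  apply: le_trans (ler_wpM2r ML hM) _.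
  by rewrite mulrC ler_pdivrMr; lra.
pose t0 := T - h; have t0_ge0 : 0 <= t0 by rewrite subr_ge0.
have t0T : 0 <= t0 < T by rewrite t0_ge0/= /t0; lra.
have sol0 := hU _ t0T; have [cu0 _ _] := sol0.
have [m m0 hm] := continuous_bounded_itv (- r) t0 cu0.
(* The factor 2 comes from solving [K <= M * m + K / 2 + h * (M * |B 0|)] for the maximum [K] on the
   last stretch; [m] covers the times before it. *)
exists (m + 2 * (M * m + h * (M * `|B 0|))).
  by rewrite addr_ge0// mulr_ge0// addr_ge0// mulr_ge0// ?mulr_ge0//;
    exact: ltW.
move=> s t /[dup] sT /andP[s0 s_T] /andP[rt ts].
have sol := hU _ sT; have [cu _ _] := sol.
have [tm tmI hmax] : exists2 tm, tm \in `[- r, s] &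
    forall t, t \in `[- r, s] -> `|U s t| <= `|U s tm|.
  apply: (@EVT_max R (fun t => `|U s t|)); first lra.
  by apply: continuous_subspaceT => x; apply: cvg_norm; exact: cu.
apply: le_trans (hmax t _) _; first by rewrite in_itv/= rt.
move: tmI; rewrite in_itv/= => /andP[rtm tms].
have MB : 0 <= h * (M * `|B 0|) by rewrite !mulr_ge0// ltW.
have Mm : 0 <= M * m by rewrite mulr_ge0.
have [tmt0|t0tm] := leP tm t0.
  rewrite (solution_unique sol sol0)//; apply: le_trans (hm _ _) _.
    by rewrite rtm.
  by rewrite lerDl mulr_ge0// addr_ge0.
set K := `|U s tm| in hmax *.
have K0 : 0 <= K by exact: normr_ge0.
have tmt0 : 0 <= tm - t0 by rewrite subr_ge0 ltW.
have tmh : tm - t0 <= h by rewrite /t0; lra.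
have KE : K <= M * m + (tm - t0) * (M * ((LB + d) * K + `|B 0|)).
  rewrite {1}/K (@solution_restart phi s (U s) t0 tm)//; last first.
    by rewrite t0_ge0 ltW.
  apply: le_trans (ler_normD _ _) _; apply: lerD.
    apply: le_trans (SM _ _ _) _; first by rewrite tmt0/=; lra.
    rewrite ler_wpM2l// (solution_unique sol sol0)//; last by lra.
      by apply: hm; rewrite lexx andbT; lra.
    by lra.
  apply: duhamel_norm => //.
  - by apply: shift_continuous; exact: forcing_continuous.
  - by move=> x /andP[x0 xt] y; apply: SM; rewrite x0/=; lra.
  move=> x /andP[x0 xt]; apply: forcing_norm => // y /andP[y1 y2].
  by apply: hmax; rewrite in_itv/=; apply/andP; split; lra.
have : (tm - t0) * (M * ((LB + d) * K + `|B 0|)) <=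
    h * (M * (LB + d)) * K + h * (M * `|B 0|).
  rewrite -mulrA -mulrDr -mulrA -mulrDr ler_wpM2r// mulr_ge0// addr_ge0//.
  by rewrite mulr_ge0// addr_ge0.
have : h * (M * (LB + d)) * K <= 2^-1 * K by rewrite ler_wpM2r.
move: KE MB Mm; lra.
Qed.

Lemma continuation phi T : 0 < T ->
  (forall s, 0 <= s < T -> exists u, solution phi s u) ->
  exists u, solution phi T u.
Proof.
move=> T0 ex; have rp := r0.
have /choice[U hU'] s : exists u, 0 <= s < T -> solution phi s u.
  have [/ex[u hu]|] := boolP (0 <= s < T); first by exists u.
  by exists (fun=> 0).
have hU s : 0 <= s < T -> solution phi s (U s) by exact: hU'.
have [K K0 hK] := solution_bounded T0 hU.
have [M M1 SM] := semigroup_bound HS T.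
have M0 : 0 <= M by exact: le_trans ler01 M1.
pose Kf := (LB + d) * K + `|B 0|.
have Kf0 : 0 <= Kf by rewrite addr_ge0// mulr_ge0// addr_ge0.
have /cauchy_cvgP/cvg_ex[l hl] : cauchy (U t t @[t --> T^'-]).
  apply: cauchy_exP => e e0.
  (* After [t1 = T - h] the Duhamel term stays below [h * (M * Kf) < e / 2], while the semigroup
     term [S (t - t1) (U t1 t1)] converges as [t] tends to [T]. The values near [T] thus lie in a
     ball around [S (T - t1) (U t1 t1)]. *)
  pose h := Num.min T (e / 2 / (M * Kf + 1)).
  have MK0 : 0 <= M * Kf by rewrite mulr_ge0.
  have h0 : 0 < h by rewrite lt_min T0 !divr_gt0//; lra.
  have hT : h <= T by rewrite ge_min lexx.
  have he : h * (M * Kf) < e / 2.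
    apply: (@lt_le_trans _ _ (h * (M * Kf + 1))).
      by rewrite ltr_pM2l// ltrDl.
    by rewrite -ler_pdivlMr ?ge_min ?lexx ?orbT//; lra.
  pose t1 := T - h; have t10 : 0 <= t1 by rewrite subr_ge0.
  have t1T : 0 <= t1 < T by rewrite t10/= /t1; lra.
  have t1E : T - t1 = h by rewrite /t1; ring.
  clearbody t1.
  exists (S (T - t1) (U t1 t1)).
  have e2 : 0 < e / 2 by rewrite divr_gt0.
  have cont : S (Num.max 0 (t - t1)) (U t1 t1) @[t --> T] -->
      S (Num.max 0 (T - t1)) (U t1 t1).
    apply: (semigroup_cvg HS); last exact: cvg_cst.
    by apply: cvgB; [exact: cvg_id|exact: cvg_cst].
  have /cvgrPdist_lt/(_ _ e2) near1 := cvg_at_left_filter cont.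
  suff h' : \forall t \near T^'-, ball (S (T - t1) (U t1 t1)) e (U t t)
    by exact: h'.
  near=> t; rewrite /= -ball_normE/=.
  have tT : t < T by near: t; exact: nbhs_left_lt.
  have t1t : t1 < t by near: t; apply: nbhs_left_gt; case/andP: t1T.
  have tI : 0 <= t < T by rewrite tT andbT; lra.
  have solt := hU _ tI.
  rewrite (solution_restart solt (t0 := t1)) ?t10 ?(ltW t1t)//.
  rewrite -(solution_unique (hU _ t1T) solt) ?(ltW t1t)//; last by lra.
  rewrite opprD addrA (le_lt_trans (ler_normB _ _))// [ltRHS]splitr ltr_leD//.
    have -> : S (t - t1) (U t1 t1) = S (Num.max 0 (t - t1)) (U t1 t1).
      by rewrite max_r// subr_ge0 ltW.
    by near: t; rewrite max_r ?subr_ge0 in near1; [|lra].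
  apply: le_trans (ltW he); apply: le_trans (_ : (t - t1) * (M * Kf) <= _);
    last first.
    by rewrite ler_wpM2r//; lra.
  apply: duhamel_norm => //; first by rewrite subr_ge0 ltW.
  - apply: shift_continuous; apply: forcing_continuous; by case: solt.
  - by move=> x /andP[x0 xt] y; apply: SM; rewrite x0/=; lra.
  move=> x /andP[x0 xt]; apply: forcing_norm => [|y /andP[y1 y2]]; first
    by case: solt.
  by apply: hK => //; apply/andP; split; lra.
(* Each time before [T] uses its own member of the family; by uniqueness any later member gives the
   same value, which is [uE]. *)
pose u t := if t < T then U (Num.max 0 t) (Num.max (- r) t) else l.
have uE s t : 0 <= s < T -> t <= s -> u t = U s (Num.max (- r) t).
  move=> /[dup] sI /andP[s0 sT] ts; rewrite /u (le_lt_trans ts sT).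
  apply: (@solution_unique phi (Num.max 0 t) s).
  - by apply: hU; rewrite le_max lexx gt_max T0 (le_lt_trans ts).
  - exact: hU.
  - by rewrite le_max lexx.
  - by rewrite ge_max !le_max lexx orbT oppr_le0 (ltW r0).
  - by rewrite ge_max ts andbT; lra.
have cu : continuous u.
  move=> t; have [tT|Tt] := ltP t T.
    pose s := (Num.max 0 t + T) / 2.
    have tm : Num.max 0 t < T by rewrite gt_max T0.
    have tm0 : 0 <= Num.max 0 t by rewrite le_max lexx.
    have tm1 : t <= Num.max 0 t by rewrite le_max lexx orbT.
    have sI : 0 <= s < T by rewrite /s; apply/andP; split; lra.
    have ts : t < s by rewrite /s; lra.
    suff h : u x @[x --> t] --> u t by exact: h.
    rewrite [X in _ --> X](uE s t sI (ltW ts)).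
    have c : U s (Num.max (- r) x) @[x --> t] --> U s (Num.max (- r) t).
      have [cU _ _] := hU _ sI.
      exact: (@cvg_comp _ _ _ _ (U s) _ _ _ (@maxr_continuous R (- r) t) (@cU
        _)).
    apply: cvg_trans c; apply: near_eq_cvg; near=> x.
    by rewrite (uE s)//; apply/ltW; near: x; exact: lt_nbhsl.
  apply/cvgrPdist_lt => e e0.
  have uT : u t = l by rewrite /u (ltNge t) Tt.
  move/cvgrPdist_lt : hl => /(_ _ e0)/nbhs_ballP[rho /= rho0 hrho].
  near=> x; rewrite uT; have [Tx|xT] := leP T x; first
    by rewrite /u (ltNge x) Tx subrr normr0.
  have x0 : 0 <= x by apply/ltW; near: x; apply: lt_nbhsr; lra.
  have xI : 0 <= x < T by rewrite x0.
  rewrite (uE x x xI (lexx x)).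
  rewrite max_r; last by lra.
  apply: hrho => //; rewrite /ball/= gtr0_norm ?subr_gt0//.
  have : `|t - x| < rho by near: x; exact: near_distr.
  by rewrite ltr_norml; lra.
exists u; have solu s : 0 <= s < T -> solution phi s u.
  move=> /[dup] sI /andP[s0 _]; apply: (solution_ext s0 (hU _ sI) cu).
  by move=> x /andP[rx xs]; rewrite (uE s)// max_r.
have [|_ u0 _] := solu 0; first by rewrite lexx.
split=> // t /andP[t0]; rewrite le_eqVlt => /predU1P[->|tT]; last first.
  have [|_ _ m] := solu t; first by rewrite t0.
  by apply: m; rewrite t0 lexx.
(* The mild formula holds on [0, T[ and both sides are continuous at [T]. *)
pose D x := u x - (S (Num.max 0 x) (u 0) + duhamel S (forcing u) (Num.max 0 x)).
have cD : continuous D.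
  move=> x; apply: cvgB; first exact: cu.
  apply: cvgD; first exact: (semigroup_orbit_continuous HS).
  by apply: (duhamel_continuous HS) => //; exact: forcing_continuous.
suff /eqP : D T = 0.
  by rewrite /D max_r ?(ltW T0)// subr_eq0 => /eqP.
apply/eqP; rewrite -normr_le0; apply/ler_addgt0Pl => e e0; rewrite addr0.
have /cvgrPdist_lt/(_ _ e0) nD := cvg_at_left_filter (cD T).
near (T^'-) => x.
have xT : x < T by near: x; exact: nbhs_left_lt.
have x0 : 0 < x by near: x; exact: nbhs_left_gt.
have Dx : D x = 0.
  have [|_ _ m] := solu x; first by rewrite xT ltW.
  by rewrite /D max_r ?(ltW x0)// -m ?subrr// lexx ltW.
have : `|D T - D x| < e by near: x; exact: nD.
by rewrite Dx subr0 => /ltW.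
Unshelve. all: end_near. Qed.

(** If [T] were not reached, the times that are reached would form an interval bounded by [T]; its
    supremum is reached by [continuation] and then exceeded by [local_existence]. *)
Lemma existence phi T : 0 <= T -> exists u, solution phi T u.
Proof.
move=> T0; apply: contrapT => nT.
pose E := [set s | 0 <= s /\ exists u, solution phi s u].
have Edown s s' : 0 <= s' -> s' <= s -> E s -> E s'.
  move=> s'0 ss [_ [u [cu u0 mu]]]; split=> //; exists u; split=> //.
  exact: mild_le mu.
have [delta [delta0 [v [cv v0 mv]]]] := local_existence phi.
have Edelta : E delta by split; [exact: ltW|exists v].
have ubE : ubound E T.
  move=> s Es; rewrite leNgt; apply/negP => /ltW Ts.
  by apply: nT; have [] := Edown _ _ T0 Ts Es.
have supE : has_sup E by split; [exists delta|exists T].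
set s := sup E.
have s0 : 0 < s by apply: lt_le_trans delta0 _; apply: ub_le_sup => //;
  exists T.
have [_ [u solu]] : E s.
  split; first exact: ltW.
  apply: continuation => // s' /andP[s'0 s's].
  have ss' : 0 < s - s' by rewrite subr_gt0.
  have [e Ee] := sup_adherent ss' supE; rewrite opprB addrCA subrr addr0 =>
    /ltW s'e.
  by have [] := Edown _ _ s'0 s'e Ee.
have [cu u0 mu] := solu.
have [rho [rho0 [w [cw w0 mw]]]] := local_existence (segment u s).
have wu x : - r <= x <= 0 -> w x = u (x + s).
  move=> rx; have := segment_apply 0 cw rx; rewrite add0r => <-.
  by rewrite w0 segment_apply// addrC.
have w00 : w 0 = u s by rewrite wu ?add0r// lexx oppr_le0 ltW.
(* Clamping both arguments and subtracting the common value at [s] glues [u] and [w] into a sum of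
   continuous functions. *)
pose z x := u (Num.min x s) + (w (Num.max 0 (x - s)) - u s).
have cz : continuous z.
  move=> x; apply: cvgD.
    exact: (@cvg_comp _ _ _ (fun x =>
      Num.min x s) u _ _ _ (@minr_continuous R s x) (@cu _)).
  apply: cvgB; last exact: cvg_cst.
  have h : y - s @[y --> x] --> x - s by apply: cvgB;
    [exact: cvg_id|exact: cvg_cst].
  have h' : Num.max 0 (y - s) @[y --> x] --> Num.max 0 (x - s).
    exact: (@cvg_comp _ _ _ _ (Num.max 0) _ _ _ h (@max0_continuous R _)).
  exact: (@cvg_comp _ _ _ _ w _ _ _ h' (@cw _)).
have zu x : x <= s -> z x = u x.
  by move=> xs; rewrite /z min_l// max_l ?subr_le0// w00 subrr addr0.
have [_ z0 mz] : solution phi s z.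
  by apply: (solution_ext (ltW s0) solu cz) => x /andP[_ xs]; exact: zu.
have [_ _ mz'] : solution (segment u s) rho (fun x => z (x + s)).
  apply: (@solution_ext _ _ _ w (ltW rho0)) => //;
    first exact: shift_continuous.
  move=> x /andP[rx _]; have [x0|x0] := leP x 0.
    by rewrite zu ?gerDr// wu// rx.
  rewrite /z addrK min_r ?lerDr ?(ltW x0)// max_r ?(ltW x0)//.
  by rewrite addrC subrK.
have : s + rho <= s.
  apply: ub_le_sup; first by exists T.
  split; first by rewrite addr_ge0// ltW.
  by exists z; split=> //; apply: mild_cat => //; exact: ltW.
by rewrite gerDl leNgt rho0.
Qed.

Lemma global_existence phi : exists u, forall T, 0 <= T -> solution phi T u.
Proof.
have /choice[U hU] T : exists u, 0 <= T -> solution phi T u.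
  have [/(existence phi)[u]|_] := boolP (0 <= T); first by exists u.
  by exists (fun=> 0).
pose u t := U (Num.max 0 t + 1) (Num.max (- r) t).
have uE s t : 0 <= s -> t <= s -> u t = U s (Num.max (- r) t).
  move=> s0 ts; have m0 : 0 <= Num.max 0 t by rewrite le_max lexx.
  have mt : t <= Num.max 0 t by rewrite le_max lexx orbT.
  have rp := r0.
  rewrite /u; apply: (@solution_unique phi (Num.max 0 t + 1) s).
  - by apply: hU; rewrite addr_ge0.
  - exact: hU.
  - by rewrite le_max lexx.
  - by rewrite ge_max; apply/andP; split; lra.
  - by rewrite ge_max ts andbT; lra.
have cu : continuous u.
  (* Since [s > t], a whole neighbourhood of [t] lies before [s], and there the path is given by
     [U s] alone. *)
  move=> t; set s := Num.max 0 t + 1.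
  have m0 : 0 <= Num.max 0 t by rewrite le_max lexx.
  have mt : t <= Num.max 0 t by rewrite le_max lexx orbT.
  have s0 : 0 <= s by rewrite addr_ge0.
  have ts : t < s by rewrite /s; lra.
  suff h : u x @[x --> t] --> u t by exact: h.
  rewrite [X in _ --> X](uE s t s0 (ltW ts)).
  have c : U s (Num.max (- r) x) @[x --> t] --> U s (Num.max (- r) t).
    have [cU _ _] := hU _ s0.
    exact: (@cvg_comp _ _ _ _ (U s) _ _ _ (@maxr_continuous R (- r) t) (@cU _)).
  apply: cvg_trans c; apply: near_eq_cvg; near=> x.
  by rewrite (uE s)//; apply/ltW; near: x; exact: lt_nbhsl.
exists u => T T0; apply: (solution_ext T0 (hU _ T0) cu) => t /andP[rt tT].
by rewrite (uE T)// max_r.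
Unshelve. all: end_near. Qed.

(** * Global mild solutions and the dynamical system *)

Local Notation mild_solution := (mild_solution S d (delay_term B eta)).
Local Notation global_mild_solution :=
  (global_mild_solution S d (delay_term B eta)).

Lemma solution_mild phi T u : solution phi T u -> mild_solution phi T u.
Proof.
move=> [cu u0 mu]; split.
- exact: continuous_subspaceT.
- by move=> s rs; rewrite -u0 segment_apply// add0r.
move=> t /[dup] tT /andP[t0 _]; exists (duhamel S (forcing u) t).
  have cI := @duhamel_integrand_continuous _ _ _ HS _ t (forcing_continuous cu).
  apply: Riemann_integral_ext (rintegralP t0 cI) => s /andP[s0 st].
  by rewrite /duhamel_integrand max_r ?subr_ge0.
rewrite -u0 segment_apply ?add0r ?addr0//; first exact: mu.
by rewrite lexx oppr_le0 ltW.
Qed.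

Lemma solution_global_mild phi u : (forall T, 0 <= T -> solution phi T u) ->
  global_mild_solution phi u.
Proof.
move=> solu; split; last by move=> T T0; apply/solution_mild/solu/ltW.
by have [cu _ _] := solu 0 (lexx 0); exact: continuous_subspaceT.
Qed.

(** Continuity of [v] is only given on [[- r, +oo[]; precomposing with [Num.max (- r)] changes
    nothing there and gives a path continuous on the whole line, to which uniqueness and stability
    apply. *)
Lemma global_mild_solutionP phi v : global_mild_solution phi v ->
  exists2 u, (forall t, - r <= t -> u t = v t) &
    forall T, 0 <= T -> solution phi T u.
Proof.
move=> [cv mv]; pose u := v \o Num.max (- r).
have uv t : - r <= t -> u t = v t by move=> rt; rewrite /u/= max_r.
have cu : continuous u.
  apply: (within_continuous_retract cv); first exact: maxr_continuous.
  by move=> s; rewrite /= in_itv/= le_max lexx.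
exists u => // T T0; split=> //.
  have [_ v0 _] := mv 1 ltr01; apply: historyE => s /=; rewrite in_itv/= => rs.
  by rewrite segment_apply// add0r uv ?v0//; case/andP: rs.
(* [global_mild_solution] provides the mild formula for positive horizons, whereas [T] may be 0. *)
move=> t /andP[t0 tT]; have T1 : 0 < T + 1 by rewrite ltr_wpDl.
have [_ v0 mvT] := mv _ T1.
have [|I fI vt] := mvT t; first by rewrite t0/= (le_trans tT)// lerDl.
have rn : - r <= 0 by rewrite oppr_le0 ltW.
rewrite uv ?(le_trans rn)// vt uv// v0 ?rn ?lexx//; congr (_ + _).
apply/esym/rintegral_eq => //; apply: Riemann_integral_ext fI => s /andP[s0 st].
rewrite /duhamel_integrand max_r ?subr_ge0// /forcing uv ?(le_trans rn)//.
rewrite (@segment_eq u v s)// ?s0 ?lexx// => x /andP[rx _]; exact: uv.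
Qed.

Theorem delay_equation_global_solution phi : exists u,
  global_mild_solution phi u /\
  forall v, global_mild_solution phi v -> forall t, - r <= t -> v t = u t.
Proof.
have [u solu] := global_existence phi; exists u; split.
  exact: solution_global_mild.
move=> v /global_mild_solutionP[w wv solw] t rt; rewrite -wv//.
have m0 : 0 <= Num.max 0 t by rewrite le_max lexx.
have mt : t <= Num.max 0 t by rewrite le_max lexx orbT.
exact: (solution_unique (solw _ m0) (solu _ m0)).
Qed.

(** The semigroup law is translation invariance: the solution shifted by [tau] is the global
    solution with initial function [segment u tau]. Continuity in time is that of [segment u], and
    continuity in the initial function is [stability]. *)
Theorem delay_equation_dynamical_system (Phi : R -> history r H ->
  history r H) :
  (forall t phi u, 0 <= t -> global_mild_solution phi u ->
     Phi t phi = segment u t) ->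
  dynamical_system Phi.
Proof.
move=> hPhi.
have flow phi : exists2 u, (forall T, 0 <= T -> solution phi T u) &
    forall t, 0 <= t -> Phi t phi = segment u t.
  have [u solu] := global_existence phi; exists u => // t t0.
  exact/hPhi/solution_global_mild.
split.
- move=> phi; have [u solu ->//] := flow phi.
  by have [] := solu 0 (lexx 0).
- move=> t tau t0 tau0 phi; have [u solu uE] := flow phi.
  have [cu _ _] := solu 0 (lexx 0).
  rewrite (uE _ tau0) (uE _ (addr_ge0 t0 tau0)) -segment_shift.
  apply: hPhi => //; apply: solution_global_mild => T T0; split.
  + exact: shift_continuous.
  + by rewrite segment_shift add0r.
  + by apply: mild_shift => //; have [] := solu _ (addr_ge0 tau0 T0).
- move=> phi; have [u solu uE] := flow phi.
  have [cu _ _] := solu 0 (lexx 0).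
  apply: (@subspace_eq_continuous _ _ _ (segment u)).
    by move=> t; rewrite inE/= in_itv/= andbT => t0 /=; exact/esym/uE.
  exact/continuous_subspaceT/segment_continuous.
- move=> t t0 phi_ phi phi_cvg; have [u solu uE] := flow phi.
  apply/cvgrPdist_le => e e0; have [cu u0 mu] := solu _ t0.
  have [rho rho0 h] := stability cu t0 mu e0.
  move/cvgrPdist_lt : phi_cvg => /(_ _ rho0); apply: filterS => k.
  rewrite !sub0r !normrN !normr_id => hk.
  have [w solw wE] := flow (phi_ k); have [cw w0 mw] := solw _ t0.
  rewrite uE// wE//; apply: h => //; first by rewrite u0 w0.
  by rewrite t0 lexx.
Qed.

End delay.

Unset Implicit Arguments.

Theorem theorem1 (R : realType) (n : nat) (Omega : smooth_bounded_domain R n)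
    (r d : R) (A : operator (L2 Omega)) (expA : R -> L2 Omega -> L2 Omega)
    (Theta_u Theta_l eta : history r (L2 Omega) -> R)
    (B : L2 Omega -> L2 Omega) :
  0 < r -> 0 <= d ->
  densely_defined A -> self_adjoint A -> positive_operator A ->
  compact_resolvent A ->
  semigroup_generated_by_opp A expA ->
  continuous Theta_u -> continuous Theta_l ->
  (forall phi, 0 <= Theta_l phi /\ Theta_l phi <= Theta_u phi /\
               Theta_u phi <= r) ->
  (forall phi, 0 < Theta_l phi) ->
  continuous eta ->
  (forall phi, 0 <= eta phi <= r) ->
  (forall phi psi : history r (L2 Omega),
     (forall theta, - Theta_u phi <= theta <= - Theta_l phi ->
        psi theta = phi theta) ->
     eta psi = eta phi) ->
  (exists L_B : R, forall v1 v2, `|B v1 - B v2| <= L_B * `|v1 - v2|) ->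
  (forall phi : history r (L2 Omega), exists u : R -> L2 Omega,
     global_mild_solution expA d (delay_term B eta) phi u /\
     forall v, global_mild_solution expA d (delay_term B eta) phi v ->
       forall t, - r <= t -> v t = u t) /\
  (forall S : R -> history r (L2 Omega) -> history r (L2 Omega),
     (forall t phi u, 0 <= t ->
        global_mild_solution expA d (delay_term B eta) phi u ->
        S t phi = segment r u t) ->
     dynamical_system S).
Proof.
move=> r0 d0 _ _ _ _ [HS _] _ Theta_l_cont Theta_itv Theta_l_gt0 eta_cont.
move=> eta_itv eta_ignore [L hL].
(* The given Lipschitz constant carries no sign condition; its absolute value is again one. *)
have L0 : 0 <= `|L| by exact: normr_ge0.
have B_lip v1 v2 : `|B v1 - B v2| <= `|L| * `|v1 - v2|.
  by rewrite (le_trans (hL _ _))// ler_wpM2r// ler_norm.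
have Theta_u_le phi : Theta_u phi <= r by have [_ []] := Theta_itv phi.
split=> [phi|Phi hPhi].
  exact: (delay_equation_global_solution HS r0 d0 Theta_l_cont Theta_u_le
    Theta_l_gt0 eta_cont eta_itv eta_ignore L0 B_lip).
exact: (delay_equation_dynamical_system HS r0 d0 Theta_l_cont Theta_u_le
  Theta_l_gt0 eta_cont eta_itv eta_ignore L0 B_lip hPhi).
Qed.
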